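(* Let $(X,d,\mu)$ be a complete metric space equipped with a doubling Borel measure $\mu$, suppose that $X$ satisfies an annular decay property, and let $1<p,s<\infty$. A weight $w$ on $X$ belongs to $A_p(X)\cap RH_s(X)$ if and only if $w=w_1w_2$ for some $w_1\in A_1(X)\cap RH_s(X)$ and $w_2\in A_p(X)\cap RH_\infty(X)$.
   Context: Balls $B=B(x,r)$ are open, and $2B=B(x,2r)$. The measure $\mu$ is doubling: there is $C_d>1$ such that $0<\mu(2B)\le C_d\,\mu(B)<\infty$ for all balls $B\subset X$. $L^1_{\mathrm{loc}}(X)$ is the set of functions integrable on every compact subset of $X$. Annular decay property: for some $0<\alpha\le 1$ there is $C\ge 1$ such that for every $x\in X$, $r>0$ and $0<\delta<1$, $\mu(B(x,r)\setminus B(x,(1-\delta)r))\le C\delta^\alpha\mu(B(x,r))$. A weight is a nonnegative function $w\in L^1_{\mathrm{loc}}(X)$ with $w>0$ $\mu$-a.e.; members of the classes below are weights. All conditions are over all balls $B\subset X$. $w\in A_p(X)$, $1<p<\infty$, if $\sup_B\left(\frac{1}{\mu(B)}\int_B w\,d\mu\right)\left(\frac{1}{\mu(B)}\int_B w^{-1/(p-1)}\,d\mu\right)^{p-1}<\infty$. $w\in A_1(X)$ if there is $C<\infty$ with $\frac{1}{\mu(B)}\int_B w\,d\mu\le C\operatorname{ess\,inf}_B w$ for every $B$. $w\in RH_s(X)$, $1<s<\infty$, if there is $C<\infty$ with $\left(\frac{1}{\mu(B)}\int_B w^s\,d\mu\right)^{1/s}\le C\,\frac{1}{\mu(B)}\int_B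 w\,d\mu$ for every $B$. $w\in RH_\infty(X)$ if there is $C<\infty$ with $\operatorname{ess\,sup}_B w\le C\,\frac{1}{\mu(B)}\int_B w\,d\mu$ for every $B$. *)

(* Defs.v *)
From HB Require Import structures.
From mathcomp Require Import all_boot all_order all_algebra.
From mathcomp Require Import all_classical all_reals all_analysis.
From mathcomp Require Import ess_sup_inf.

Set Implicit Arguments.
Unset Strict Implicit.
Unset Printing Implicit Defensive.

Import Order.TTheory GRing.Theory Num.Theory.
Import numFieldNormedType.Exports.

Local Open Scope classical_set_scope.
Local Open Scope ring_scope.

#[short(type="completeMetricType")]
HB.structure Definition CompleteMetric (K : numDomainType) :=
  {M of Complete M & Metric K M}.

Notation borelType X := (g_sigma_algebraType (@open X)).

Section weights.
Context {R : realType} {X : completeMetricType R}.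

Lemma open_mball (x : X) (r : R) : open (ball x r).
Proof.
rewrite openE => y; rewrite ballEmdist /= => xy.
apply/nbhs_ballP; exists (r - mdist x y); first by rewrite /= subr_gt0.
move=> z; rewrite !ballEmdist /= ltrBrDl; apply: le_lt_trans.
exact: metric_triangle.
Qed.

Lemma measurable_mball (x : X) (r : R) :
  measurable (ball x r : set (borelType X)).
Proof. by apply: sub_sigma_algebra; exact: open_mball. Qed.

Variable mu : {measure set (borelType X) -> \bar R}.
Implicit Types (w f : X -> R) (x : X) (r p s : R).

Local Open Scope ereal_scope.

Definition doubling := exists Cd : R, (1 < Cd)%R /\
  forall x r, (0 < r)%R ->
    [/\ 0 < mu (ball x (2 * r)),
        mu (ball x (2 * r)) <= Cd%:E * mu (ball x r)
      & Cd%:E * mu (ball x r) < +oo].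

Definition annular_decay := exists alpha : R, (0 < alpha <= 1)%R /\
  exists C : R, (1 <= C)%R /\
  forall x r (delta : R), (0 < r)%R -> (0 < delta < 1)%R ->
    mu (ball x r `\` ball x ((1 - delta) * r)) <=
      (C * delta `^ alpha)%:E * mu (ball x r).

Definition L1loc f :=
  measurable_fun [set: borelType X] (f : borelType X -> R) /\
  forall K : set X, compact K -> mu.-integrable K (EFin \o f).

Definition weight w := [/\ forall y, (0 <= w y)%R, L1loc w
  & {ae mu, forall y : borelType X, (0 < w y)%R}].

Definition avg x r f : \bar R :=
  (mu (ball x r))^-1 * \int[mu]_(y in ball x r) (f y)%:E.

Definition ess_sup_ball x r f :=
  ess_sup (mrestr mu (measurable_mball x r)) (EFin \o f).

Definition ess_inf_ball x r f :=
  ess_inf (mrestr mu (measurable_mball x r)) (EFin \o f).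

(* [powR] sends 0 to 0 for negative exponents; this does not affect the
   integral of w `^ (- (p - 1)^-1) since a weight vanishes only on a null set. *)
Definition in_Ap p w := weight w /\
  ereal_sup [set avg x r w *
      (avg x r (fun y => (w y `^ (- (p - 1)^-1))%R)) `^ (p - 1)
    | x in [set: X] & r in [set r : R | (0 < r)%R]] < +oo.

Definition in_A1 w := weight w /\
  exists C : R, forall x r, (0 < r)%R ->
    avg x r w <= C%:E * ess_inf_ball x r w.

Definition in_RH s w := weight w /\
  exists C : R, forall x r, (0 < r)%R ->
    (avg x r (fun y => (w y `^ s)%R)) `^ (s^-1) <= C%:E * avg x r w.

Definition in_RHoo w := weight w /\
  exists C : R, forall x r, (0 < r)%R ->
    ess_sup_ball x r w <= C%:E * avg x r w.

End weights.

(* Main.v *)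
From HB Require Import structures.
Require Import Defs.
From mathcomp Require Import all_boot all_order all_algebra.
From mathcomp Require Import all_classical all_reals all_analysis.
From mathcomp Require Import measurable_realfun ess_sup_inf.
From mathcomp Require Import ring lra.

(** With [r = s (p - 1)], the weight [w] lies in [A_p] and [RH_s] iff [v = w^s] and
    [sg = w^(-1/(p-1))] satisfy [(int_B v) (int_B sg)^r <= A mu(B)^(r+1)] on all
    balls; moreover [v sg^r = 1]. Hence [v dmu] and [sg dmu] are doubling, and the
    Hardy-Littlewood maximal operators [M_v], [M_sg] of these two measures are
    bounded on [L^(q')(v)] and [L^q(sg)], [q = r + 1]. Rubio de Francia's iteration
    applied to both operators at once gives [z > 0] with [M_sg z <= C z] and
    [M_v (z^r / v) <= C z^r / v]. As in Lerner's proof of Muckenhoupt's theorem, the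
    [A_q] bound converts these two estimates into the [A_1] condition with respect
    to [mu] for [z^r] and for [z sg]. Then [w1 = z^(p-1)] and
    [w2 = z^(-(p-1)) w = (z sg)^(-(p-1))] are the factors. The maximal operators run
    over a countable family of balls that captures every ball up to a factor 4, so
    measurability is immediate and Vitali's lemma is only needed for finite
    families. *)

Set Implicit Arguments.
Unset Strict Implicit.
Unset Printing Implicit Defensive.

Import Order.TTheory GRing.Theory Num.Theory.
Import numFieldNormedType.Exports.

Local Open Scope classical_set_scope.
Local Open Scope ring_scope.

(** The value of [r] is forced: [RH_s] bounds (avg v)^(1/s) by the average of [w], so the [A_p]
    product gives (avg v)^(1/s) (avg sg)^(p-1) <= C, and its s-th power is the condition on (v, sg)
    with r = s (p - 1). Maximal operators of the weighted measures are chosen because for them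
    doubling alone gives boundedness. They act on different spaces; since v^(-q') v = sg, the map z
    -> z^r / v carries the L^q(sg) norm to the L^q'(v) norm, so [M_v] becomes an operator on L^q(sg)
    and can share one iteration with [M_sg]. Inequalities of Hoelder and Jensen type enter as
    pointwise bounds 1 <= a f + b g or f <= a + b g, integrated over a ball with [a] and [b] read
    off from averages; this costs factors of 2. The final classes come from two facts: if f^s
    satisfies an [A_1] estimate then [f] is in [A_1] and [RH_s], and the power -(p - 1) of such a
    function is in [A_p] and [RH_oo]. For the converse, [A_1] bounds [w1] below and [RH_oo] bounds
    [w2] above on each ball, so each integral of a power of [w] reduces to a single factor. *)

Section ereal_powers.
Local Open Scope ereal_scope.
Context (R : realType).
Implicit Types (x y : \bar R) (r : R).

Lemma le_poweR x y r : (0 <= r)%R -> 0 <= x -> x <= y -> x `^ r <= y `^ r.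
Proof.
move=> r0 x0 xy; apply: gt0_ler_poweR => //; rewrite in_itv/= leey ?andbT//.
exact: le_trans xy.
Qed.

Lemma poweRK x r : (r != 0)%R -> 0 <= x -> (x `^ r) `^ r^-1 = x.
Proof. by move=> r0 x0; rewrite -poweRrM divff// poweRe1. Qed.

Lemma poweRVK x r : (r != 0)%R -> 0 <= x -> (x `^ r^-1) `^ r = x.
Proof. by move=> r0 x0; rewrite -poweRrM mulVf// poweRe1. Qed.

Lemma poweR_ereal_sup (u : nat -> \bar R) r : (0 < r)%R -> (forall n, 0 <= u n) ->
  ereal_sup (range u) `^ r = ereal_sup (range (fun n => u n `^ r)).
Proof.
move=> r0 u0.
have s0 : 0 <= ereal_sup (range u).
  by apply: le_trans (u0 0%N) _; apply: ereal_sup_ubound; exists 0%N.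
have s1 : 0 <= ereal_sup (range (fun n => u n `^ r)).
  by apply: le_trans (poweR_ge0 (u 0%N) r) _; apply: ereal_sup_ubound; exists 0%N.
apply/eqP; rewrite eq_le; apply/andP; split.
  rewrite -[leRHS](@poweRVK _ r) ?gt_eqF//; apply: le_poweR => //; first exact: ltW.
  apply: ub_ereal_sup => _ [n _ <-].
  rewrite -[leLHS](@poweRK _ r) ?gt_eqF//; apply: le_poweR.
  - by rewrite invr_ge0 ltW.
  - exact: poweR_ge0.
  - by apply: ereal_sup_ubound; exists n.
apply: ub_ereal_sup => _ [n _ <-]; apply: le_poweR => //; first exact: ltW.
by apply: ereal_sup_ubound; exists n.
Qed.

End ereal_powers.

Lemma measurable_fun_poweR d (T : measurableType d) (R : realType)
  (g : T -> \bar R) (r : R) : measurable_fun setT g ->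
  measurable_fun setT (fun x => poweR (g x) r).
Proof. by move=> mg; apply: (measurableT_comp (measurable_poweR _)). Qed.

Lemma measurable_ereal_sup d (T : measurableType d) (R : realType)
  (f : nat -> T -> \bar R) : (forall n, measurable_fun setT (f n)) ->
  measurable_fun setT (fun x => ereal_sup (range (f ^~ x))).
Proof.
move=> mf; rewrite (_ : (fun x => _) = (fun x => esups (f ^~ x) 0%N)).
  exact: measurable_fun_esups.
apply/funext => x; rewrite /esups /sdrop/=; congr ereal_sup.
by apply/seteqP; split => [_ [i _ <-]|_ [i _ <-]]; exists i.
Qed.

Section integral_sup.
Local Open Scope ereal_scope.
Context d (T : measurableType d) (R : realType) (mu : {measure set T -> \bar R}).
Variables (A : set T) (f : nat -> T -> \bar R).
Hypotheses (mA : measurable A) (mf : forall n, measurable_fun A (f n)).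
Hypotheses (f0 : forall n x, A x -> 0 <= f n x).
Hypothesis ndf : forall x, A x -> nondecreasing_seq (f ^~ x).

(** Monotone convergence, with the increasing limit written as a supremum because that is how the
    limit of the iteration is defined. *)
Lemma integral_sup_le (c : \bar R) : (forall n, \int[mu]_(x in A) f n x <= c) ->
  \int[mu]_(x in A) ereal_sup (range (f ^~ x)) <= c.
Proof.
move=> fc; rewrite (_ : \int[mu]_(x in A) _ = \int[mu]_(x in A) limn (f ^~ x)).
  rewrite monotone_convergence//; apply: lime_le; last exact: nearW.
  apply: ereal_nondecreasing_is_cvgn => a b ab; apply: ge0_le_integral => //.
  - by move=> x; exact: f0.
  - by move=> x Ax; exact: ndf.
apply: eq_integral => x; rewrite inE => Ax; apply/esym/cvg_lim => //.
by apply: ereal_nondecreasing_cvgn; exact: ndf.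
Qed.

End integral_sup.

Lemma integral_indicM d (T : measurableType d) (R : realType)
  (nu : {measure set T -> \bar R}) (A : set T) (g : T -> \bar R) :
  (\int[nu]_x ((\1_A x)%:E * g x) = \int[nu]_(x in A) g x)%E.
Proof.
rewrite [RHS]integral_mkcond epatch_indic.
by apply: eq_integral => x _; rewrite muleC.
Qed.

Lemma ae_imp d (T : measurableType d) (R : realType)
  (mu : {measure set T -> \bar R}) (P Q : T -> Prop) :
  {ae mu, forall t, P t} -> (forall t, P t -> Q t) -> {ae mu, forall t, Q t}.
Proof. by move=> aeP PQ; move: aeP; apply: filterS. Qed.

(** * Integrating inequalities that hold almost everywhere *)

Section ae_integral.
Local Open Scope ereal_scope.
Context d (T : measurableType d) (R : realType) (mu : {measure set T -> \bar R}).
Implicit Types (E : set T) (f g : T -> R).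

(** Some pointwise estimates are needed at one point only, for instance to see that the integral
    they bound is finite; a set of positive measure supplies that point. *)
Lemma ae_exists E (P : T -> Prop) : measurable E -> 0 < mu E ->
  {ae mu, forall x, E x -> P x} -> exists x, E x /\ P x.
Proof.
move=> mE E0 [N [mN N0 sub]]; apply: contrapT => /forallNP nP.
move: E0; rewrite (_ : mu E = 0) ?ltxx//.
apply: (subset_measure0 mE mN _ N0) => x Ex; apply: sub => /(_ Ex) Px.
exact: (nP x).
Qed.

Lemma ae_gt0_integral E f : measurable E -> measurable_fun setT f ->
  (forall x, (0 <= f x)%R) -> {ae mu, forall x, (0 < f x)%R} ->
  0 < mu E -> 0 < \int[mu]_(x in E) (f x)%:E.
Proof.
move=> mE mf f0 aef E0; rewrite lt_neqAle integral_ge0 ?andbT; last first.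
  by move=> x _; rewrite lee_fin.
apply/negP => /eqP I0.
have mfE : measurable_fun E (EFin \o f) by apply/measurable_EFinP/measurable_funTS.
have [h _] := ae_eq_integral_abs mu mE mfE.
have := h _; rewrite (_ : \int[mu]_(x in E) _ = 0); last first.
  by rewrite I0; apply: eq_integral => x _; rewrite gee0_abs// lee_fin.
move=> /(_ erefl) f00.
have [x [Ex [fx]]] : exists x, E x /\ ((0 < f x)%R /\ (EFin \o f) x = 0).
  apply: ae_exists => //; move: aef f00; apply: filterS2 => x fx f0x Ex.
  by split => //; exact: f0x.
by move=> -[] fx0; rewrite fx0 ltxx in fx.
Qed.

Lemma ae_cst_le_integral E f (c m I : R) : measurable E -> measurable_fun setT f ->
  (forall x, (0 <= f x)%R) -> (0 <= c)%R ->
  mu E = m%:E -> \int[mu]_(x in E) (f x)%:E = I%:E ->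
  {ae mu, forall x, E x -> (c <= f x)%R} -> (c * m <= I)%R.
Proof.
move=> mE mf f0 c0 Em EI aecf.
rewrite -lee_fin EFinM -Em -EI -integral_cst//; apply: ae_ge0_le_integral => //.
- by move=> x _; rewrite lee_fin.
- by apply/measurable_EFinP/measurable_funTS.
Qed.

(** Takes the part of Hoelder's inequality: with [a] and [b] adapted to the averages, it yields
    lower bounds for products of averages. *)
Lemma le_cst_add_integral E f g (a b m I J : R) : measurable E ->
  measurable_fun setT f -> measurable_fun setT g ->
  (forall x, (0 <= f x)%R) -> (forall x, (0 <= g x)%R) -> (0 <= a)%R -> (0 <= b)%R ->
  mu E = m%:E -> \int[mu]_(x in E) (f x)%:E = I%:E ->
  \int[mu]_(x in E) (g x)%:E = J%:E ->
  {ae mu, forall x, E x -> (1 <= a * f x + b * g x)%R} -> (m <= a * I + b * J)%R.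
Proof.
move=> mE mf mg f0 g0 a0 b0 Em EI EJ h.
have mfE : measurable_fun E (EFin \o f) by apply/measurable_EFinP/measurable_funTS.
have mgE : measurable_fun E (EFin \o g) by apply/measurable_EFinP/measurable_funTS.
rewrite -[leLHS]mul1r; apply: (ae_cst_le_integral (E := E) (f := fun x => a * f x + b * g x)%R) => //.
- by apply: measurable_funD; apply: measurable_funM.
- by move=> x; rewrite addr_ge0// mulr_ge0.
rewrite (_ : (fun x => _) = (fun x => a%:E * (f x)%:E + b%:E * (g x)%:E)); last first.
  by apply/funext => x; rewrite EFinD !EFinM.
rewrite ge0_integralD//.
- rewrite !ge0_integralZl ?lee_fin//.
  + by rewrite EI EJ -!EFinM -EFinD.
  + by move=> x _; rewrite lee_fin.
  + by move=> x _; rewrite lee_fin.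
- by move=> x _; rewrite mule_ge0 ?lee_fin.
- exact: measurable_funeM.
- by move=> x _; rewrite mule_ge0 ?lee_fin.
- exact: measurable_funeM.
Qed.

(** Finiteness of the integral of [f] is part of the conclusion, as a real value [J], so that later
    computations stay in [R]. With [a = 0] this compares [f] to a multiple of [g], with [b = 0] to a
    constant. *)
Lemma integral_affine_le (E : set T) (f g : T -> R) (a b m I : R) : measurable E ->
  measurable_fun setT f -> measurable_fun setT g ->
  (forall x, (0 <= f x)%R) -> (forall x, (0 <= g x)%R) -> (0 <= a)%R -> (0 <= b)%R ->
  mu E = m%:E -> \int[mu]_(x in E) (g x)%:E = I%:E ->
  {ae mu, forall x, E x -> (f x <= a + b * g x)%R} ->
  exists2 J : R, \int[mu]_(x in E) (f x)%:E = J%:E & (J <= a * m + b * I)%R.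
Proof.
move=> mE mf mg f0 g0 a0 b0 Em EI h.
have mfE : measurable_fun E (EFin \o f) by apply/measurable_EFinP/measurable_funTS.
have mgE : measurable_fun E (EFin \o g) by apply/measurable_EFinP/measurable_funTS.
have le : \int[mu]_(x in E) (f x)%:E <= (a * m + b * I)%:E.
  apply: (@le_trans _ _ (\int[mu]_(x in E) (a%:E + b%:E * (g x)%:E))).
    apply: ae_ge0_le_integral => //.
    - by move=> x _; rewrite lee_fin.
    - by move=> x _; rewrite adde_ge0 ?mule_ge0 ?lee_fin.
    - by apply: emeasurable_funD => //; exact: measurable_funeM.
  rewrite ge0_integralD//.
  - rewrite integral_cst// ge0_integralZl ?lee_fin//.
      by rewrite Em EI EFinD !EFinM.
    by move=> x _; rewrite lee_fin.
  - by move=> x _; rewrite mule_ge0 ?lee_fin.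
  - exact: measurable_funeM.
have I0 : 0 <= \int[mu]_(x in E) (f x)%:E.
  by apply: integral_ge0 => x _; rewrite lee_fin.
have fE : \int[mu]_(x in E) (f x)%:E = (fine (\int[mu]_(x in E) (f x)%:E))%:E.
  by rewrite fineK// ge0_fin_numE// (le_lt_trans le)// ltry.
by exists (fine (\int[mu]_(x in E) (f x)%:E)) => //; rewrite -lee_fin -fE.
Qed.

Lemma ae_eq_ge0_integral (E : set T) (f g : T -> R) : measurable E ->
  measurable_fun setT f -> measurable_fun setT g ->
  (forall x, (0 <= f x)%R) -> (forall x, (0 <= g x)%R) ->
  {ae mu, forall x, f x = g x} ->
  \int[mu]_(x in E) (f x)%:E = \int[mu]_(x in E) (g x)%:E.
Proof.
move=> mE mf mg f0 g0 fg.
have mfE : measurable_fun E (EFin \o f) by apply/measurable_EFinP/measurable_funTS.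
have mgE : measurable_fun E (EFin \o g) by apply/measurable_EFinP/measurable_funTS.
apply/eqP; rewrite eq_le; apply/andP; split; apply: ae_ge0_le_integral => //.
- by move=> x _; rewrite lee_fin.
- by move=> x _; rewrite lee_fin.
- by move: fg; apply: filterS => x ->.
- by move=> x _; rewrite lee_fin.
- by move=> x _; rewrite lee_fin.
- by move: fg; apply: filterS => x ->.
Qed.

End ae_integral.

(** * The maximal theorem *)

Lemma pow2B1_gt0 (R : realType) (a : R) : 0 < a -> 0 < 2 `^ a - 1 :> R.
Proof.
move=> a0; rewrite subr_gt0 -[ltLHS](congr1 (fun f => f a) (@powR1 R)).
by rewrite gt0_ltr_powR ?nnegrE//; lra.
Qed.

(** The factor 0 or 1 keeps the levels below 2y. A geometric sum is at most its next term divided by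
    2^a - 1, and the level after the largest kept one is below 4y, whence 4^a. *)
Lemma dyadic_sum_le (R : realType) (a l y : R) (m : nat) :
  0 < a -> 0 < l -> 0 <= y ->
  \sum_(n < m) (l * 2 ^+ n) `^ a * (l * 2 ^+ n / 2 < y)%R%:R
  <= 4 `^ a / (2 `^ a - 1) * y `^ a.
Proof.
move=> a0 l0 y0.
have b1 := pow2B1_gt0 a0.
have geom k : \sum_(n < k) (l * 2 ^+ n) `^ a <= (l * 2 ^+ k) `^ a / (2 `^ a - 1).
  elim: k => [|k ih]; first by rewrite big_ord0 divr_ge0 ?powR_ge0 ?ltW.
  have l2k : 0 <= l * 2 ^+ k by rewrite mulr_ge0 ?exprn_ge0 ?ltW.
  rewrite big_ord_recr/= (_ : l * 2 ^+ k.+1 = 2 * (l * 2 ^+ k)) ?exprS; last by ring.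
  rewrite (powRM _ _ l2k)//.
  rewrite ler_pdivlMr// mulrDl [leRHS](_ : _ = (l * 2 ^+ k) `^ a + (l * 2 ^+ k) `^ a * (2 `^ a - 1)); last by ring.
  by rewrite lerD2r -ler_pdivlMr.
elim: m => [|m ih].
  by rewrite big_ord0 mulr_ge0 ?divr_ge0 ?powR_ge0 ?ltW.
rewrite big_ord_recr/=; case: ltP => [ly|]; last by rewrite mulr0 addr0.
rewrite mulr1; apply: (@le_trans _ _ (\sum_(n < m.+1) (l * 2 ^+ n) `^ a)).
  rewrite [leRHS]big_ord_recr/= lerD2r ler_sum// => i _.
  by case: (_ < _); rewrite ?mulr1 ?mulr0 ?powR_ge0.
rewrite (le_trans (geom _))// mulrAC ler_wpM2r ?invr_ge0 ?(ltW b1)//.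
rewrite -powRM// ge0_ler_powR ?nnegrE ?(ltW a0)//.
- by rewrite mulr_ge0 ?exprn_ge0 ?ltW.
- by rewrite mulr_ge0.
- rewrite exprS; lra.
Qed.

(** [2 * K] is the weak-type constant, 2^p pays for rounding a value up to twice a dyadic level, and
    the last factor is that of [dyadic_sum_le] for the exponent p - 1. *)
Definition maximal_constant (R : realType) (K p : R) : R :=
  2 * K * 2 `^ p * (4 `^ (p - 1) / (2 `^ (p - 1) - 1)).

Lemma maximal_constant_gt0 (R : realType) (K p : R) :
  0 < K -> 1 < p -> 0 < maximal_constant K p.
Proof.
move=> K0 p1; rewrite !mulr_gt0 ?powR_gt0 ?invr_gt0//.
by rewrite pow2B1_gt0// subr_gt0.
Qed.

Definition vitali_covering (T : Type) (B B3 : nat -> set T) :=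
  forall s : seq nat, exists t : seq nat,
  [/\ uniq t, {subset t <= s}, trivIset [set` t] B &
      forall i, i \in s -> exists2 j, j \in t & B i `<=` B3 j].

Section hardy_littlewood.
Local Open Scope ereal_scope.
Context d (T : measurableType d) (R : realType).
Variable nu : {measure set T -> \bar R}.
Variables (B B3 : nat -> set T) (K : R).
Hypothesis mB : forall i, measurable (B i).
Hypothesis mB3 : forall i, measurable (B3 i).
Hypothesis nuB : forall i, 0 < nu (B i) < +oo.
Hypothesis K0 : (0 < K)%R.
Hypothesis nuB3 : forall i, nu (B3 i) <= K%:E * nu (B i).
Hypothesis vitali : vitali_covering B B3.

(** The uncentred maximal operator of the family. The indicator turns sets missing [x] into terms
    equal to 0, harmless for [g >= 0], so the supremum is over all of [nat] and measurable in
    [x]. *)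
Definition maximal (g : T -> \bar R) (x : T) : \bar R :=
  ereal_sup (range (fun i =>
    ((fine (nu (B i)))^-1 * \1_(B i) x)%:E * \int[nu]_(y in B i) g y)).

Let nuBE i : nu (B i) = (fine (nu (B i)))%:E.
Proof. by rewrite fineK// ge0_fin_numE//; case/andP: (nuB i). Qed.

Let fnuB_gt0 i : (0 < fine (nu (B i)))%R.
Proof. by rewrite -lte_fin -nuBE; case/andP: (nuB i). Qed.

Lemma maximal_ge0 g x : (forall y, 0 <= g y) -> 0 <= maximal g x.
Proof.
move=> g0; apply: ereal_sup_ge; eexists; first by exists 0%N.
by rewrite mule_ge0 ?integral_ge0// lee_fin mulr_ge0// invr_ge0 ltW.
Qed.

Implicit Types (g h : T -> \bar R) (x : T).

Lemma le_maximal g h x : (forall y, 0 <= g y) ->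
  measurable_fun setT g -> measurable_fun setT h ->
  (forall y, g y <= h y) -> maximal g x <= maximal h x.
Proof.
move=> g0 mg mh gh; apply: ub_ereal_sup => _ [i _ <-].
apply: ereal_sup_ge; eexists; first by exists i.
apply: lee_wpmul2l; first by rewrite lee_fin mulr_ge0// invr_ge0 ltW.
by apply: ge0_le_integral => //; exact: measurable_funTS.
Qed.

Lemma integral_le_maximal g i x : (forall y, 0 <= g y) -> B i x ->
  \int[nu]_(y in B i) g y <= nu (B i) * maximal g x.
Proof.
move=> g0 Bx; rewrite nuBE -lee_pdivrMl//.
apply: ereal_sup_ge; eexists; first by exists i.
by rewrite indicE mem_set// mulr1.
Qed.

Lemma measurable_maximal g : measurable_fun setT (maximal g).
Proof.
apply: measurable_ereal_sup => i.
apply: emeasurable_funM => //; apply/measurable_EFinP.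
by apply: measurable_funM => //; exact: measurable_indic.
Qed.

(** The part of the superlevel set of [maximal g] that the first [N] sets detect; a finite union, so
    that the finite covering lemma applies. *)
Definition level (g : T -> \bar R) (N : nat) (l : R) : set T :=
  \big[setU/set0]_(i <- [seq i <- iota 0 N |
    `[< l%:E * nu (B i) < \int[nu]_(y in B i) g y >]]) B i.

Lemma measurable_level g N l : measurable (level g N l).
Proof. exact: bigsetU_measurable. Qed.

Lemma levelP g N (l : R) x : level g N l x <->
  exists i, [/\ (i < N)%N, l%:E * nu (B i) < \int[nu]_(y in B i) g y & B i x].
Proof.
rewrite /level -bigcup_seq; split => [[i]|[i [iN li Bx]]].
  rewrite /mkset mem_filter mem_iota => /andP[/asboolP li iN] Bx.
  by exists i.
by exists i => //; rewrite /mkset mem_filter mem_iota/= iN andbT; exact/asboolP.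
Qed.

(** Weak type (1,1), localised to where [g] exceeds half the level: on a set with average above [l],
    the points with g <= l/2 contribute at most half of [l * nu (B i)], so the others carry the
    other half. The covering lemma makes the sets disjoint at the cost of [K]. *)
Lemma nu_level g N (l : R) : measurable_fun setT g -> (forall y, 0 <= g y) ->
  (0 < l)%R ->
  nu (level g N l) <=
    (2 * K / l)%:E * \int[nu]_(x in [set x | (l / 2)%:E < g x]) g x.
Proof.
move=> mg g0 l0.
have mA : measurable [set x | (l / 2)%:E < g x].
  by rewrite -[X in measurable X]setTI; exact: emeasurable_fun_o_infty.
set A := [set x | _] in mA *.
pose s := [seq i <- iota 0 N | `[< l%:E * nu (B i) < \int[nu]_(y in B i) g y >]].
have [t [ut ts tB cov]] := vitali s.
have sub : level g N l `<=` \big[setU/set0]_(j <- t) B3 j.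
  move=> x; rewrite /level -bigcup_seq => -[i /cov[j jt sub] Bx].
  by rewrite -bigcup_seq; exists j => //; exact: sub.
apply: (le_trans (le_measure _ _ _ sub)); rewrite ?inE.
- exact: measurable_level.
- exact: bigsetU_measurable.
apply: (@le_trans _ _ (\sum_(j <- t) nu (B3 j))).
  elim: (t) => [|j u ih]; first by rewrite !big_nil measure0.
  rewrite !big_cons (le_trans (measureU2 _ _ _))//; first exact: bigsetU_measurable.
  by rewrite leeD2l.
have tint j : j \in t -> nu (B3 j) <=
    (2 * K / l)%:E * \int[nu]_(x in A `&` B j) g x.
  move=> /ts; rewrite mem_filter => /andP[/asboolP lt _].
  apply: (le_trans (nuB3 _)).
  have -> : (2 * K / l = K * (2 / l))%R by ring.
  rewrite EFinM -muleA; apply: lee_wpmul2l; first by rewrite lee_fin ltW.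
  rewrite -[X in X%:E * _]invf_div lee_pdivlMl ?divr_gt0//.
  have lnu : (l / 2)%:E * nu (B j) + (l / 2)%:E * nu (B j) = l%:E * nu (B j).
    by rewrite -ge0_muleDl ?lee_fin ?divr_ge0 ?ltW// -EFinD -splitr.
  rewrite -(@leeD2lE _ ((l / 2)%:E * nu (B j))); last first.
    by rewrite nuBE -EFinM.
  rewrite lnu (le_trans (ltW lt))//.
  have -> : \int[nu]_(y in B j) g y =
      \int[nu]_(y in B j `\` A) g y + \int[nu]_(y in A `&` B j) g y.
    rewrite -ge0_integral_setU//.
    - by rewrite setIC setUC setUIDK.
    - exact: measurableD.
    - exact: measurableI.
    - exact: measurable_funTS.
    - by rewrite setIC disj_set2E; apply/eqP/seteqP; split => // x [[_ ?] [_ ?]].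
  rewrite leeD2r//.
  apply: (@le_trans _ _ (\int[nu]_(y in B j `\` A) (l / 2)%:E)).
    apply: ge0_le_integral => //.
    - exact: measurableD.
    - exact: measurable_funTS.
    - by move=> x [_ /negP]; rewrite -leNgt.
  rewrite integral_cst//; last exact: measurableD.
  apply: lee_wpmul2l; first by rewrite lee_fin divr_ge0 ?ltW.
  by apply: le_measure; rewrite ?inE//; exact: measurableD.
rewrite big_seq (le_trans (lee_sum _ tint))// -big_seq -ge0_sume_distrr; last first.
  by move=> j _; exact: integral_ge0.
rewrite lee_wpmul2l//.
  by rewrite lee_fin divr_ge0 ?mulr_ge0 ?ltW.
rewrite -(@ge0_integral_bigsetU _ _ _ nu _ (fun j => A `&` B j))//.
- apply: ge0_subset_integral => //.
  + by apply: bigsetU_measurable => i _; exact: measurableI.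
  + exact: measurable_funTS.
  + by rewrite -bigcup_seq => x [i _ []].
- by move=> i; exact: measurableI.
- by apply: trivIset_setIl.
- exact: measurable_funTS.
Qed.

Section strong_type.
Variables (p : R) (p1 : (1 < p)%R) (g : T -> \bar R).
Hypotheses (mg : measurable_fun setT g) (g0 : forall y, 0 <= g y).

(* For [n < 2 N] these levels run over the powers of 2 from [2^-N] to [2^(N-1)]. *)
Let lev (N n : nat) : R := ((2 ^+ N)^-1 * 2 ^+ n)%R.

Let lev_gt0 N n : (0 < lev N n)%R.
Proof. by rewrite mulr_gt0 ?invr_gt0 ?exprn_gt0. Qed.

(** A discrete layer-cake sum that dominates the p-th power of the maximal function in the limit.
    The factor 2 is there because a value may reach twice the largest dyadic level lying below
    it. *)
Let layer (N : nat) (x : T) : \bar R := \sum_(n < N.*2)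
  ((2 * lev N n) `^ p * \1_(level g N (lev N n)) x)%:E.

Local Notation Cst := (maximal_constant K p).

Let Cst_gt0 : (0 < Cst)%R. Proof. exact: maximal_constant_gt0. Qed.

Let measurable_layer N : measurable_fun setT (layer N).
Proof.
apply: emeasurable_sum => n; apply/measurable_EFinP; apply: measurable_funM => //.
by apply: measurable_indic; exact: measurable_level.
Qed.

Let layer_ge0 N x : 0 <= layer N x.
Proof. by apply: sume_ge0 => n _; rewrite lee_fin mulr_ge0 ?powR_ge0. Qed.

Let mgp : measurable_fun setT (fun x => g x `^ p).
Proof. exact: measurable_fun_poweR. Qed.

Let integral_layer N :
  \int[nu]_x layer N x <= Cst%:E * \int[nu]_x (g x `^ p).
Proof.
pose A n : set T := [set x | (lev N n / 2)%:E < g x].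
have mA n : measurable (A n).
  by rewrite -[X in measurable X]setTI; exact: emeasurable_fun_o_infty.
rewrite /layer ge0_integral_sum//; last 2 first.
- move=> n; apply/measurable_EFinP; apply: measurable_funM => //.
  by apply: measurable_indic; exact: measurable_level.
- by move=> n x _; rewrite lee_fin mulr_ge0 ?powR_ge0.
(* The product of the weight (2 lev)^p and the weak-type constant 2 K / lev. *)
pose c n := (2 * K * 2 `^ p * lev N n `^ (p - 1))%R.
have c0 n : (0 <= c n)%R by rewrite !mulr_ge0 ?powR_ge0 ?(ltW K0).
have mt n : measurable_fun setT (fun x => (c n * \1_(A n) x)%:E * g x).
  apply: emeasurable_funM => //; apply/measurable_EFinP.
  by apply: measurable_funM => //; exact: measurable_indic.
have t0 n x : 0 <= (c n * \1_(A n) x)%:E * g x.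
  by rewrite mule_ge0// lee_fin mulr_ge0.
apply: (@le_trans _ _ (\sum_(n < N.*2) \int[nu]_x
    ((c n * \1_(A n) x)%:E * g x))).
  apply: lee_sum => n _.
  under eq_integral do rewrite EFinM.
  rewrite ge0_integralZl//; last 2 first.
  - apply/measurable_EFinP; apply: measurable_indic; exact: measurable_level.
  - by rewrite lee_fin powR_ge0.
  rewrite integral_indic//; last exact: measurable_level.
  rewrite setIT.
  have mAg : measurable_fun setT (fun x => (\1_(A n) x)%:E * g x).
    by apply: emeasurable_funM => //; apply/measurable_EFinP; exact: measurable_indic.
  under [leRHS]eq_integral do rewrite EFinM -muleA.
  rewrite ge0_integralZl//; last 2 first.
  - by move=> x _; rewrite mule_ge0// lee_fin.
  - by rewrite lee_fin.
  rewrite integral_indicM.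
  apply: (@le_trans _ _ (((2 * lev N n) `^ p)%:E *
      ((2 * K / lev N n)%:E * \int[nu]_(x in A n) g x))).
    apply: lee_wpmul2l; first by rewrite lee_fin powR_ge0.
    exact: nu_level.
  rewrite muleA -EFinM powRM//; last exact: ltW.
  rewrite -[in leLHS](@mulr_powRB1 _ (lev N n)) ?(lt_trans _ p1)//; last exact: ltW.
  apply: lee_wpmul2r; first exact: integral_ge0.
  rewrite lee_fin le_eqVlt; apply/orP; left; apply/eqP; rewrite /c.
  by field; rewrite gt_eqF.
rewrite -ge0_integral_sum// -ge0_integralZl//; last 2 first.
- by move=> x _; exact: poweR_ge0.
- by rewrite lee_fin ltW.
apply: ge0_le_integral => //.
- by move=> x _; apply: sume_ge0.
- exact: emeasurable_sum.
- exact: emeasurable_funM.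
move=> x _.
have AE n : \1_(A n) x = ((lev N n / 2)%:E < g x)%E%:R :> R.
  by rewrite indicE; congr (_%:R); congr nat_of_bool; apply/idP/idP; rewrite inE.
under eq_bigr do rewrite AE.
have := g0 x; case: (g x) => [y| |//]; last first.
  by rewrite poweRyr ?gt_eqF ?(lt_trans _ p1)// gt0_muley ?leey.
rewrite lee_fin => y0; rewrite poweR_EFin.
under eq_bigr do rewrite lte_fin -EFinM.
rewrite sumEFin -EFinM lee_fin -mulr_suml.
under eq_bigr do rewrite -mulrA.
(* One factor of y^p comes from the weak-type integral of [g]; the sum over levels has to supply the
   remaining y^(p-1). *)
rewrite -mulr_sumr -(mulr_powRB1 y0) ?(lt_trans _ p1)//.
have := @dyadic_sum_le _ (p - 1) (2 ^+ N)^-1 y N.*2.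
rewrite subr_gt0 invr_gt0 exprn_gt0// => /(_ p1 isT y0) h.
rewrite [leRHS](_ : _ = 2 * K * 2 `^ p *
  (4 `^ (p - 1) / (2 `^ (p - 1) - 1) * y `^ (p - 1)) * y)%R; last first.
  by rewrite /maximal_constant; ring.
by rewrite ler_wpM2r// ler_wpM2l// !mulr_ge0 ?powR_ge0 ?ltW.
Qed.

(** Passing from [N] to [N.+1] adds one level at each end and lets one more set into every level
    set; the old level [n] reappears with index [n.+1]. *)
Let layer_nd x : nondecreasing_seq (layer ^~ x).
Proof.
apply/nondecreasing_seqP => N; rewrite /layer doubleS big_ord_recl big_ord_recr/=.
rewrite [leRHS]addeA.
apply: (@le_trans _ _ (\sum_(i < N.*2) ((2 * lev N.+1 (bump 0 i)) `^ p *
    \1_(level g N.+1 (lev N.+1 (bump 0 i))) x)%:E)).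
  apply: lee_sum => n _; rewrite lee_fin.
  have -> : lev N.+1 (bump 0 n) = lev N n.
    by rewrite /lev /bump add1n !exprS invfM; field; rewrite ?expf_neq0.
  rewrite ler_wpM2l ?powR_ge0// !indicE ler_nat.
  case: (boolP (x \in level g N _)) => //; rewrite inE => /levelP[i [iN li Bx]].
  by rewrite mem_set//; apply/levelP; exists i; split => //; exact: ltnW.
rewrite addeAC leeDr// adde_ge0// lee_fin mulr_ge0 ?powR_ge0//.
Qed.

Let layer_ge x (t : R) : (0 < t)%R -> t%:E < maximal g x ->
  exists N, (t `^ p)%:E <= layer N x.
Proof.
move=> t0 /ereal_sup_gt[_ [i _ <-] ti].
have Bx : B i x.
  apply: contrapT => nBx; move: ti.
  by rewrite indicE memNset// mulr0 mul0e lte_fin ltNge ltW.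
have {}ti : t%:E * nu (B i) < \int[nu]_(y in B i) g y.
  by move: ti; rewrite indicE mem_set// mulr1 lte_pdivlMl// -nuBE muleC.
have pow2_gt (y : R) : (0 <= y)%R -> exists k, (y < 2 ^+ k)%R.
  move=> y0; exists (Num.bound y); rewrite (lt_trans (archi_boundP y0))//.
  by rewrite -natrX ltr_nat ltn_expl.
have [k tk] := pow2_gt _ (ltW t0).
have [m tm] : exists m, (t^-1 < 2 ^+ m)%R by apply: pow2_gt; rewrite invr_ge0 ltW.
(* [N] is large enough for the set [B i] to be seen, for the top level to reach [t / 2], and for the
   bottom level to be below [t]. The least [n] with t <= 2 lev then satisfies lev < t, so [x] lies
   in that level set and its term alone is at least t^p. *)
pose N := maxn i.+1 (maxn k m).
have iN : (i < N)%N by rewrite leq_maxl.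
have kN : (k <= N)%N by rewrite /N leq_max leq_maxl orbT.
have mN : (m <= N)%N by rewrite /N !leq_max leqnn !orbT.
have P0 : (t <= 2 * lev N N.*2.-1)%R.
  rewrite /lev mulrCA -exprS prednK ?double_gt0 ?(leq_trans _ iN)//.
  rewrite -addnn exprD mulKf ?expf_neq0// (le_trans (ltW tk))//.
  by rewrite ler_eXn2l// ltr1n.
have := ex_intro (fun n => (t <= 2 * lev N n)%R) _ P0.
move=> /ex_minnP[n tn nmin].
have nN : (n < N.*2)%N.
  by rewrite (leq_ltn_trans (nmin _ P0))// prednK// double_gt0 (leq_trans _ iN).
have levt : (lev N n < t)%R.
  case: (n) nmin => [nmin|n' nmin].
    rewrite /lev expr0 mulr1 invf_plt ?posrE ?exprn_gt0//.
    by rewrite (lt_le_trans tm)// ler_eXn2l// ltr1n.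
  rewrite (_ : lev N n'.+1 = 2 * lev N n')%R; last by rewrite /lev exprS mulrCA.
  by rewrite ltNge; apply/negP => /nmin; rewrite ltnn.
exists N; rewrite /layer (bigD1 (Ordinal nN))//=.
rewrite -[leLHS]adde0 leeD//; last first.
  by apply: sume_ge0 => j _; rewrite lee_fin mulr_ge0 ?powR_ge0.
rewrite lee_fin indicE mem_set ?mulr1.
  by rewrite ge0_ler_powR ?nnegrE ?mulr_ge0 ?(ltW (lt_trans _ p1))// ltW.
apply/levelP; exists i; split => //.
rewrite (le_lt_trans _ ti)//; apply: lee_wpmul2r => //.
by rewrite lee_fin ltW.
Qed.

(** Marcinkiewicz interpolation: [nu_level] has already cut [g] at half the level, and summation
    over dyadic levels replaces the layer-cake integral. *)
Lemma integral_maximal_poweR :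
  \int[nu]_x (maximal g x `^ p) <= Cst%:E * \int[nu]_x (g x `^ p).
Proof.
have cvl x : layer ^~ x @ \oo --> ereal_sup (range (layer ^~ x)).
  exact: ereal_nondecreasing_cvgn.
apply: (@le_trans _ _ (\int[nu]_x limn (layer ^~ x))).
  apply: ge0_le_integral => //.
  - by move=> x _; exact: poweR_ge0.
  - apply: measurable_fun_poweR; exact: measurable_maximal.
  - apply: emeasurable_fun_cvg measurable_layer _ => x _.
    by rewrite (cvg_lim _ (cvl x)).
  move=> x _; rewrite (cvg_lim _ (cvl x))//.
  set S := ereal_sup _.
  have tS t : (0 < t)%R -> t%:E < maximal g x -> (t `^ p)%:E <= S.
    by move=> t0 /(layer_ge t0)[N] /le_trans; apply; apply: ereal_sup_ubound; exists N.
  have : 0 <= S by apply: (le_trans (layer_ge0 0 x)); apply: ereal_sup_ubound; exists 0%N.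
  case: S tS => [s tS|_ _|//]; last exact: leey.
  rewrite lee_fin => s0.
  have p0 : (0 < p)%R by exact: lt_trans p1.
  (* [tS] speaks only of [t] strictly below the maximal function, which may be infinite; a real [t]
     between s^(1/p) and it gives the contradiction. *)
  suff : maximal g x <= (s `^ p^-1)%:E.
    move=> /(gt0_ler_poweR (ltW p0)); rewrite poweR_EFin -powRrM mulVf ?gt_eqF//.
    by rewrite powRr1//; apply; rewrite in_itv/= leey ?maximal_ge0 ?lee_fin ?powR_ge0.
  rewrite leNgt; apply/negP => lts.
  have [t /andP[st tm]] : exists t : R, ((s `^ p^-1 < t)%R && (t%:E < maximal g x)).
    move: lts; case: (maximal g x) => [r| |//].
      rewrite lte_fin => /midf_lt[h1 h2].
      by exists ((s `^ p^-1 + r) / 2)%R; rewrite h1 lte_fin.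
    by move=> _; exists (s `^ p^-1 + 1)%R; rewrite ltrDl ltr01 ltry.
  have t0 : (0 < t)%R by rewrite (le_lt_trans _ st)// powR_ge0.
  have := tS _ t0 tm; rewrite lee_fin leNgt => /negP; apply.
  have := gt0_ltr_powR p0 _ _ st; rewrite -powRrM mulVf ?gt_eqF// powRr1//.
  by apply; rewrite nnegrE ?powR_ge0 ?ltW.
rewrite monotone_convergence//.
apply: lime_le; last by apply: nearW => N; exact: integral_layer.
apply: ereal_nondecreasing_is_cvgn => a b ab; apply: ge0_le_integral => //.
by move=> x _; exact: layer_nd.
Qed.

End strong_type.
End hardy_littlewood.

(** * Measures with a density *)

Section density.
Local Open Scope ereal_scope.
Context d (T : measurableType d) (R : realType).
Variables (mu : {measure set T -> \bar R}) (v : T -> R).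

(** The two proofs are arguments so that the measure structure can be attached to the term
    [density mv v0] itself. *)
Definition density of measurable_fun setT v & (forall x, (0 <= v x)%R) :=
  fun A : set T => \int[mu]_(x in A) (v x)%:E.

Hypotheses (mv : measurable_fun setT v) (v0 : forall x, (0 <= v x)%R).
Local Notation nu := (density mv v0).

Let nu0 : nu set0 = 0. Proof. exact: integral_set0. Qed.

Let nu_ge0 A : 0 <= nu A.
Proof. by apply: integral_ge0 => x _; rewrite lee_fin. Qed.

Let nu_sigma_additive : semi_sigma_additive nu.
Proof.
move=> F mF tF mUF; rewrite /density ge0_integral_bigcup//.
- by apply: is_cvg_ereal_nneg_natsum_cond => n _ _; exact: nu_ge0.
- by apply/measurable_EFinP; exact: measurable_funTS.
- by move=> x _; rewrite lee_fin.
Qed.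

HB.instance Definition _ := isMeasure.Build _ _ _ nu nu0 nu_ge0 nu_sigma_additive.

Import HBNNSimple.

Let mEv : measurable_fun setT (EFin \o v).
Proof. exact/measurable_EFinP. Qed.

Let integralT_density_nnsfun (h : {nnsfun T >-> R}) :
  \int[nu]_x (h x)%:E = \int[mu]_x ((h x)%:E * (v x)%:E).
Proof.
rewrite integralT_nnsfun sintegralE.
transitivity (\int[mu]_x (\sum_(r \in range h)
    (r * \1_(h @^-1` [set r]) x)%:E * (v x)%:E)); last first.
  apply: eq_integral => x _; rewrite [in RHS](fimfunE h x) -fsumEFin//.
  by rewrite ge0_mule_fsuml// => r; exact: nnfun_muleindic_ge0.
rewrite ge0_integral_fsum//; last 2 first.
- move=> r; apply: emeasurable_funM => //; apply/measurable_EFinP.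
  by apply: measurable_funM => //; exact: measurable_indic.
- by move=> r x _; rewrite mule_ge0 ?lee_fin//; exact: nnfun_muleindic_ge0.
apply: eq_fsbigr => r; rewrite inE => -[t _ <-].
under eq_integral do rewrite EFinM -muleA.
rewrite ge0_integralZl ?integral_indicM//.
- by apply: emeasurable_funM => //; apply/measurable_EFinP; exact: measurable_indic.
- by move=> x _; rewrite mule_ge0 ?lee_fin.
- by rewrite lee_fin.
Qed.

Let integralT_density (f : T -> \bar R) :
  measurable_fun setT f -> (forall x, 0 <= f x) ->
  \int[nu]_x f x = \int[mu]_x (f x * (v x)%:E).
Proof.
move=> mf f0; pose h := nnsfun_approx measurableT mf.
have fE x : (EFin \o h n) x @[n --> \oo] --> f x.
  by apply: cvg_nnsfun_approx.
have hnd x : {homo (fun n => (h n x)%:E) : m n / (m <= n)%N >-> m <= n}.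
  by move=> m n mn; rewrite lee_fin; exact/lefP/nd_nnsfun_approx.
have mh n : measurable_fun setT (fun x => (h n x)%:E) by apply/measurable_EFinP.
transitivity (limn (fun n => \int[nu]_x (h n x)%:E)).
  rewrite -monotone_convergence//.
  - by apply: eq_integral => x _; rewrite (cvg_lim _ (fE x)).
  - by move=> n x _; rewrite lee_fin.
transitivity (limn (fun n => \int[mu]_x ((h n x)%:E * (v x)%:E))).
  by congr (limn _); apply/funext => n; exact: integralT_density_nnsfun.
rewrite -monotone_convergence//.
- apply: eq_integral => x _; apply/cvg_lim => //.
  by apply: cvgeZr => //; exact: fE.
- by move=> n; exact: emeasurable_funM.
- by move=> n x _; rewrite mule_ge0 ?lee_fin.
- by move=> x _ m n mn; apply: lee_wpmul2r; [rewrite lee_fin|exact: hnd].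
Qed.

Lemma integral_density (f : T -> \bar R) A : measurable A ->
  measurable_fun setT f -> (forall x, 0 <= f x) ->
  \int[nu]_(x in A) f x = \int[mu]_(x in A) (f x * (v x)%:E).
Proof.
move=> mA mf f0.
rewrite -[LHS]integral_indicM -[RHS]integral_indicM integralT_density.
- by under eq_integral do rewrite -muleA.
- by apply: emeasurable_funM => //; apply/measurable_EFinP; exact: measurable_indic.
- by move=> x; rewrite mule_ge0// lee_fin.
Qed.

End density.

(** * Rubio de Francia's iteration *)

Section rubio_de_francia.
Local Open Scope ereal_scope.
Context d (T : measurableType d) (R : realType) (nu : {measure set T -> \bar R}).
Variables (F : (T -> \bar R) -> T -> \bar R) (q : R).
Hypothesis q0 : (0 < q)%R.
Hypothesis mF : forall g, (forall x, 0 <= g x) -> measurable_fun setT g ->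
  measurable_fun setT (F g).
Hypothesis F0 : forall g, (forall x, 0 <= g x) -> forall x, 0 <= F g x.
Hypothesis homoF : forall g h, (forall x, 0 <= g x) ->
  measurable_fun setT g -> measurable_fun setT h ->
  (forall x, g x <= h x) -> forall x, F g x <= F h x.
Variable C : R.
Hypothesis C0 : (0 < C)%R.
Hypothesis FC : forall g, (forall x, 0 <= g x) -> measurable_fun setT g ->
  \int[nu]_x (F g x `^ q) <= C%:E * \int[nu]_x (g x `^ q).
Variable z0 : T -> \bar R.
Hypotheses (z0_ge0 : forall x, 0 <= z0 x) (mz0 : measurable_fun setT z0).
Hypothesis z0_fin : \int[nu]_x (z0 x `^ q) < +oo.

(** Chosen so that e^q C = 1/2: if the integral of (Z n)^q is at most 2 I, the next one is at most I
    + e^q C (2 I) = 2 I, so the bound reproduces itself. *)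
Let e : R := ((2 * C) `^ (- q^-1))%R.

Let e0 : (0 < e)%R. Proof. by rewrite powR_gt0 ?mulr_gt0. Qed.

Let eqC : (e `^ q * C = 2^-1)%R.
Proof.
rewrite /e -powRrM mulNr mulVf ?gt_eqF// powR_inv1 ?mulr_ge0 ?(ltW C0)//.
by rewrite invfM -mulrA mulVf ?mulr1 ?gt_eqF.
Qed.

Let Z n := iter n (fun z x => maxe (z0 x) (e%:E * F z x)) z0.

Let Z0 n x : 0 <= Z n x.
Proof. by case: n => [|n]//=; rewrite le_max z0_ge0. Qed.

Let mZ n : measurable_fun setT (Z n).
Proof.
elim: n => [|n ih]//=; apply: measurable_maxe => //.
by apply: measurable_funeM; exact: mF.
Qed.

Let ndZ x : nondecreasing_seq (Z ^~ x).
Proof.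
apply/nondecreasing_seqP => n; elim: n x => [|n ih] x.
  by rewrite /= le_max lexx.
rewrite [leLHS]/= ge_max; apply/andP; split; first by rewrite /= le_max lexx.
rewrite [leRHS]/= le_max; apply/orP; right.
apply: lee_wpmul2l; first by rewrite lee_fin ltW.
exact: (homoF (Z0 n) (mZ n) (mZ n.+1) ih).
Qed.

Let intZ n : \int[nu]_x (Z n x `^ q) <= 2%:E * \int[nu]_x (z0 x `^ q).
Proof.
have I0 : 0 <= \int[nu]_x (z0 x `^ q) by apply: integral_ge0 => x _; exact: poweR_ge0.
elim: n => [|n ih].
  by rewrite /= -[leLHS]mul1e; apply: lee_wpmul2r => //; rewrite lee_fin ler1n.
have mFq : measurable_fun setT (fun x => F (Z n) x `^ q).
  by apply: measurable_fun_poweR; exact: mF.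
apply: (@le_trans _ _
    (\int[nu]_x (z0 x `^ q + (e `^ q)%:E * F (Z n) x `^ q))).
  apply: ge0_le_integral => //.
  - by move=> x _; exact: poweR_ge0.
  - exact: measurable_fun_poweR.
  - apply: emeasurable_funD; first exact: measurable_fun_poweR.
    exact: measurable_funeM.
  move=> x _; rewrite -poweR_EFin -poweRM ?lee_fin ?(ltW e0)//; last exact: F0.
  rewrite [Z n.+1 x]/=; case: (leP (z0 x)) => _.
    by rewrite leeDr// poweR_ge0.
  by rewrite leeDl// poweR_ge0.
rewrite ge0_integralD//; last 4 first.
- by move=> x _; exact: poweR_ge0.
- exact: measurable_fun_poweR.
- by move=> x _; rewrite mule_ge0 ?lee_fin ?powR_ge0 ?poweR_ge0.
- exact: measurable_funeM.
rewrite ge0_integralZl//; last 2 first.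
- by move=> x _; exact: poweR_ge0.
- by rewrite lee_fin powR_ge0.
apply: (@le_trans _ _ (\int[nu]_x (z0 x `^ q) +
    (e `^ q)%:E * (C%:E * (2%:E * \int[nu]_x (z0 x `^ q))))).
  apply: leeD => //; apply: lee_wpmul2l; first by rewrite lee_fin powR_ge0.
  apply: le_trans (FC _ _) _ => //.
  by apply: lee_wpmul2l => //; rewrite lee_fin ltW.
rewrite !muleA -!EFinM -mulrA [(C * 2)%R]mulrC mulrCA eqC.
rewrite divff// mul1e.
by rewrite -[X in X + X]mul1e -ge0_muleDl// -EFinD.
Qed.

(* Rubio de Francia's algorithm with maxima in place of sums: no sublinearity of
   the operator is needed. *)
Lemma rubio_de_francia : exists e' : R, exists z : nat -> T -> \bar R,
  [/\ (0 < e')%R,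
      forall n x, 0 <= z n x /\ z0 x <= z n x,
      forall n, measurable_fun setT (z n),
      forall x, nondecreasing_seq (z ^~ x) &
      (forall n x, e'%:E * F (z n) x <= z n.+1 x) /\
      \int[nu]_x (ereal_sup (range (z ^~ x)) `^ q) < +oo].
Proof.
exists e, Z; split => //.
  by move=> n x; split => //; case: n => [|n]//=; rewrite le_max lexx.
split; first by move=> n x; rewrite /= le_max lexx orbT.
apply: (@le_lt_trans _ _ (2%:E * \int[nu]_x (z0 x `^ q))).
  under eq_integral do rewrite poweR_ereal_sup//.
  apply: integral_sup_le => //.
  - by move=> n; exact: measurable_fun_poweR.
  - by move=> n x _; exact: poweR_ge0.
  - by move=> x _ m n mn; apply: le_poweR => //; [exact: ltW|exact: ndZ].
rewrite lte_mul_pinfty ?lee_fin//.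
Qed.

End rubio_de_francia.

(** * The two weighted maximal operators on a single space *)

Section weight_pair.
Local Open Scope ereal_scope.
Context d (T : measurableType d) (R : realType) (mu : {measure set T -> \bar R}).
Variables (v s : T -> R) (r : R).
Hypothesis r0 : (0 < r)%R.
Hypotheses (mv : measurable_fun setT v) (ms : measurable_fun setT s).
Hypotheses (v0 : forall x, (0 < v x)%R) (s0 : forall x, (0 < s x)%R).
Hypothesis vs : forall x, (v x * s x `^ r = 1)%R.
Local Notation V := (density mu mv (fun x => ltW (v0 x))).
Local Notation S := (density mu ms (fun x => ltW (s0 x))).
Variables (B B3 : nat -> set T) (K : R) (i0 : nat).
Hypotheses (mB : forall i, measurable (B i)) (mB3 : forall i, measurable (B3 i)).
Hypothesis K0 : (0 < K)%R.
Hypotheses (VB : forall i, 0 < V (B i) < +oo) (SB : forall i, 0 < S (B i) < +oo).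
Hypotheses (VB3 : forall i, V (B3 i) <= K%:E * V (B i))
           (SB3 : forall i, S (B3 i) <= K%:E * S (B i)).
Hypothesis vitali : vitali_covering B B3.
Hypothesis cover : forall x, exists i, B i x /\ B i0 `<=` B i.

(** Conjugate exponents: r = q - 1 and q' = q / (q - 1). *)
Let q : R := (r + 1)%R.
Let q' : R := ((r + 1) / r)%R.

Let q1 : (1 < q)%R. Proof. by rewrite /q ltrDr. Qed.
Let q'1 : (1 < q')%R. Proof. by rewrite /q' mulrDl divff ?gt_eqF// mul1r ltrDl invr_gt0. Qed.
Let q0 : (0 < q)%R. Proof. exact: lt_trans q1. Qed.
Let q'0 : (0 < q')%R. Proof. exact: lt_trans q'1. Qed.

Let powv x : (v x `^ q' * s x = v x)%R.
Proof.
have -> : (v x = s x `^ (- r))%R.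
  by rewrite powRN -[LHS]mulr1 -(@mulfV _ (s x `^ r)) ?gt_eqF ?powR_gt0// mulrA vs mul1r.
rewrite -powRrM -[X in (_ * X)%R](powRr1 (ltW (s0 x))) -powRD; last first.
  by apply/implyP => _; rewrite gt_eqF.
by congr (_ `^ _)%R; rewrite /q'; field; rewrite gt_eqF.
Qed.

Let powVv x : ((v x)^-1 `^ q' * v x = s x)%R.
Proof.
rewrite -[X in (_ * X)%R](powv x) mulrA -powRM ?invr_ge0 ?(ltW (v0 x))//.
by rewrite mulVf ?gt_eqF// powR1 mul1r.
Qed.

(** By [powVv], the integral of (Y z)^q' against [V] equals that of z^q against [S]: [Y] transports
    L^q(S) to L^q'(V). *)
Let Y (z : T -> \bar R) (x : T) : \bar R := z x `^ r * ((v x)^-1)%:E.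

Let Y_ge0 z x : 0 <= Y z x.
Proof. by rewrite mule_ge0 ?poweR_ge0// lee_fin invr_ge0 ltW. Qed.

Let mVv : measurable_fun setT (fun x => ((v x)^-1)%:E).
Proof.
have -> : (fun x => ((v x)^-1)%:E) = (fun x => (s x `^ r)%:E).
  apply/funext => x; congr EFin.
  by rewrite -[RHS](mulKf (x := v x)) ?vs ?mulr1// gt_eqF.
by apply/measurable_EFinP; exact: (measurableT_comp (measurable_powR _) ms).
Qed.

Let mY (z : T -> \bar R) : measurable_fun setT z -> measurable_fun setT (Y z).
Proof. by move=> mz; apply: emeasurable_funM => //; exact: measurable_fun_poweR. Qed.

Let YV (z : T -> \bar R) i : measurable_fun setT z -> (forall x, 0 <= z x) ->
  \int[V]_(x in B i) Y z x = \int[mu]_(x in B i) (z x `^ r).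
Proof.
move=> mz z0; rewrite integral_density//; last exact: mY.
apply: eq_integral => x _.
by rewrite /Y -muleA -EFinM mulVf ?mule1// gt_eqF.
Qed.

(** [M_v] conjugated by [Y]: for nonnegative [z], Y (F2 z) is the maximal function of Y z for
    [V]. *)
Let F2 (z : T -> \bar R) (x : T) := ((v x)%:E * maximal V B (Y z) x) `^ r^-1.

(** Taking the maximum makes one iteration produce one function that satisfies both estimates. *)
Let F (z : T -> \bar R) (x : T) := maxe (maximal S B z x) (F2 z x).

Let mvE : measurable_fun setT (EFin \o v). Proof. exact/measurable_EFinP. Qed.
Let msE : measurable_fun setT (EFin \o s). Proof. exact/measurable_EFinP. Qed.

Let mF2 (z : T -> \bar R) : measurable_fun setT (F2 z).
Proof.
apply: measurable_fun_poweR; apply: emeasurable_funM => //.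
exact: measurable_maximal.
Qed.

Let intF : exists2 C : R, (0 < C)%R & forall g : T -> \bar R,
  (forall x, 0 <= g x) -> measurable_fun setT g ->
  \int[S]_x (F g x `^ q) <= C%:E * \int[S]_x (g x `^ q).
Proof.
pose C := maximal_constant K.
have C_gt0 p : (1 < p)%R -> (0 < C p)%R by exact: maximal_constant_gt0.
exists (C q + C q')%R => [|g g0 mg]; first by rewrite addr_gt0 ?C_gt0.
have mM : measurable_fun setT (fun x => maximal S B g x `^ q).
  by apply: measurable_fun_poweR; exact: measurable_maximal.
have mF2q : measurable_fun setT (fun x => F2 g x `^ q) by exact: measurable_fun_poweR.
apply: (@le_trans _ _ (\int[S]_x (maximal S B g x `^ q + F2 g x `^ q))).
  apply: ge0_le_integral => //.
  - by move=> x _; exact: poweR_ge0.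
  - apply: measurable_fun_poweR; apply: measurable_maxe => //.
    exact: measurable_maximal.
  - exact: emeasurable_funD.
  move=> x _; rewrite /F; case: (leP (maximal S B g x) (F2 g x)) => _.
    by rewrite leeDr// poweR_ge0.
  by rewrite leeDl// poweR_ge0.
rewrite ge0_integralD//; [|by move=> x _; exact: poweR_ge0..].
have Iq0 : 0 <= \int[S]_x (g x `^ q) by apply: integral_ge0 => x _; exact: poweR_ge0.
rewrite EFinD ge0_muleDl ?lee_fin ?(ltW (C_gt0 _ _))//; apply: leeD.
  exact: (integral_maximal_poweR mB mB3 SB K0 SB3 vitali).
have mMV : measurable_fun setT (maximal V B (Y g)) by exact: measurable_maximal.
have -> : \int[S]_x (F2 g x `^ q) = \int[V]_x (maximal V B (Y g) x `^ q').
  have mMq := measurable_fun_poweR q' mMV.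
  rewrite [LHS]integral_density//; last by move=> x; exact: poweR_ge0.
  rewrite [RHS]integral_density//; last by move=> x; exact: poweR_ge0.
  apply: eq_integral => x _.
  rewrite /F2 -poweRrM (_ : r^-1 * q = q')%R; last by rewrite /q /q' mulrC.
  rewrite poweRM ?lee_fin ?(ltW (v0 x))//; last by exact: maximal_ge0.
  by rewrite muleAC poweR_EFin -EFinM powv muleC.
have -> : \int[S]_x (g x `^ q) = \int[V]_x (Y g x `^ q').
  have mgq := measurable_fun_poweR q mg.
  have mYq := measurable_fun_poweR q' (mY mg).
  rewrite [LHS]integral_density//; last by move=> x; exact: poweR_ge0.
  rewrite [RHS]integral_density//; last by move=> x; exact: poweR_ge0.
  apply: eq_integral => x _.
  rewrite /Y poweRM ?poweR_ge0 ?lee_fin ?invr_ge0 ?(ltW (v0 x))//.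
  rewrite -poweRrM (_ : r * q' = q)%R; last by rewrite /q /q' mulrC divfK ?gt_eqF.
  by rewrite -muleA poweR_EFin -EFinM powVv.
exact: (integral_maximal_poweR mB mB3 VB K0 VB3 vitali q'1 (mY mg)).
Qed.

Let F_ge0 g : (forall x, 0 <= g x) -> forall x, 0 <= F g x.
Proof. by move=> g0 x; rewrite /F le_max maximal_ge0. Qed.

Let mF g : measurable_fun setT (F g).
Proof. by apply: measurable_maxe => //; exact: measurable_maximal. Qed.

Let homoF (g h : T -> \bar R) : (forall x, 0 <= g x) ->
  measurable_fun setT g -> measurable_fun setT h ->
  (forall x, g x <= h x) -> forall x, F g x <= F h x.
Proof.
move=> g0 mg mh gh x; rewrite /F ge_max !le_max; apply/andP; split; apply/orP.
  by left; exact: le_maximal.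
right; apply: le_poweR; first by rewrite invr_ge0 ltW.
  by rewrite mule_ge0 ?maximal_ge0// lee_fin ltW.
apply: lee_wpmul2l; first by rewrite lee_fin ltW.
apply: le_maximal => //; [exact: mY|exact: mY|move=> y].
apply: lee_wpmul2r; first by rewrite lee_fin invr_ge0 ltW.
by apply: le_poweR => //; exact: ltW.
Qed.

(** The bounds on both maximal functions, unfolded set by set. The exceptional set is where the
    limit of the iteration is infinite; it does not depend on [i], so the quantifier over [i] stays
    inside the a.e. statement. *)
Lemma weight_pair_bigger : exists C : R, exists z : T -> R,
  [/\ (0 < C)%R, measurable_fun setT z, forall x, (0 < z x)%R &
  {ae mu, forall x, forall i, B i x ->
    \int[mu]_(y in B i) (z y * s y)%:E <= C%:E * S (B i) * (z x)%:E /\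
    \int[mu]_(y in B i) (z y `^ r)%:E <= C%:E * V (B i) * (z x `^ r / v x)%:E}].
Proof.
have [C C0 FC] := intF.
(* The seed must have a finite L^q(S) norm and must not vanish almost everywhere; the indicator of
   one set of the family does both. *)
pose z0 : T -> \bar R := EFin \o \1_(B i0).
have z00 x : 0 <= z0 x by rewrite lee_fin.
have mz0 : measurable_fun setT z0.
  by apply/measurable_EFinP; exact: measurable_indic.
have z0q : \int[S]_x (z0 x `^ q) < +oo.
  rewrite (_ : (fun x => z0 x `^ q) = (EFin \o \1_(B i0))).
    by rewrite integral_indic// setIT; case/andP: (SB i0).
  apply/funext => x; rewrite /z0/= indicE.
  by case: (x \in B i0); rewrite ?powR1// powR0// gt_eqF.
have [e [z [e0 zz0 mz ndz [ze zfin]]]] :=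
  rubio_de_francia q0 (fun g _ _ => mF g) F_ge0 homoF C0 FC z00 mz0 z0q.
pose Z x := ereal_sup (range (z ^~ x)).
have zZ n x : z n x <= Z x by apply: ereal_sup_ubound; exists n.
have Z0 x : 0 <= Z x by apply: le_trans (zZ 0%N x); case: (zz0 0%N x).
have mZ : measurable_fun setT Z by exact: measurable_ereal_sup.
have zF n x : F (z n) x <= e^-1%:E * Z x.
  by rewrite lee_pdivlMl//; apply: le_trans (zZ n.+1 x); exact: ze.
have z_ge0 n x : 0 <= z n x by case: (zz0 n x).
have Z1 x i : B i x -> \int[mu]_(y in B i) (Z y * (s y)%:E) <= e^-1%:E * S (B i) * Z x.
  move=> Bx; rewrite -(integral_density mu ms (fun y => ltW (s0 y)))//; apply: integral_sup_le => //.
  - by move=> n; exact: measurable_funTS.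
  - move=> n; apply: (le_trans (integral_le_maximal SB (z_ge0 n) Bx)).
    rewrite -muleA muleCA; apply: lee_wpmul2l => //.
    by apply: le_trans (zF n x); rewrite /F le_max lexx.
have Z2 x i : B i x -> \int[mu]_(y in B i) (Z y `^ r) <=
    (e^-1 `^ r)%:E * V (B i) * (Z x `^ r * ((v x)^-1)%:E).
  move=> Bx; under eq_integral do rewrite poweR_ereal_sup//.
  apply: integral_sup_le => //.
  - by move=> n; apply: measurable_funTS; exact: measurable_fun_poweR.
  - by move=> n y _; exact: poweR_ge0.
  - by move=> y _ m n mn; apply: le_poweR => //; [exact: ltW|exact: ndz].
  move=> n; rewrite -YV//.
  apply: (le_trans (integral_le_maximal VB (Y_ge0 (z n)) Bx)).
  rewrite -muleA muleCA; apply: lee_wpmul2l => //.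
  have M0 : 0 <= maximal V B (Y (z n)) x by exact: maximal_ge0.
  rewrite muleA muleC lee_pdivlMl//.
  (* Writing the left side as an r-th power exposes [F2 (z n) x], which is at most e^-1 Z x. *)
  rewrite -[leLHS](@poweRVK _ _ r) ?gt_eqF//; last by rewrite mule_ge0// lee_fin ltW.
  rewrite -poweR_EFin -poweRM ?lee_fin ?invr_ge0 ?(ltW e0)//.
  apply: le_poweR; [exact: ltW|exact: poweR_ge0|].
  by apply: le_trans (zF n x); rewrite /F le_max lexx orbT.
(* Positivity everywhere: some [B i] contains both [x] and [B i0], so the integral of [z 0] over it
   is at least S (B i0) > 0, while it is at most S (B i) e^-1 Z x. *)
have Zgt0 x : 0 < Z x.
  have [i [Bx B0i]] := cover x.
  have : 0 < S (B i) * (e^-1%:E * Z x).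
    apply: (@lt_le_trans _ _ (S (B i0))); first by case/andP: (SB i0).
    apply: (@le_trans _ _ (\int[S]_(y in B i) z 0%N y)).
      have -> : S (B i0) = \int[S]_(y in B i) z0 y.
        by rewrite integral_indic//; congr (S _); rewrite setIidl.
      apply: ge0_le_integral => //.
      - exact: measurable_funTS.
      - exact: measurable_funTS.
      - by move=> y _; case: (zz0 0%N y).
    apply: (le_trans (integral_le_maximal SB (z_ge0 0%N) Bx)).
    apply: lee_wpmul2l => //.
    by apply: le_trans (zF 0%N x); rewrite /F le_max lexx.
  rewrite lt_neqAle => /andP[+ _]; rewrite lt_neqAle Z0 andbT.
  by apply: contraNneq => <-; rewrite !mule0.
have Zfin : {ae mu, forall x, Z x \is a fin_num}.
  have : mu.-integrable setT (fun x => Z x `^ q * (s x)%:E).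
    apply/integrableP; split.
      by apply: emeasurable_funM => //; exact: measurable_fun_poweR.
    under eq_integral do rewrite gee0_abs ?mule_ge0 ?poweR_ge0 ?lee_fin ?(ltW (s0 _))//.
    rewrite -(integral_density mu ms (fun y => ltW (s0 y)))//.
    - exact: measurable_fun_poweR.
    - by move=> x; exact: poweR_ge0.
  move=> /(integrable_ae measurableT); apply: filterS => x /(_ I).
  rewrite ge0_fin_numE ?mule_ge0 ?poweR_ge0 ?lee_fin ?(ltW (s0 _))//.
  rewrite ge0_fin_numE//; apply: contraTT; rewrite -!leNgt !leye_eq => /eqP ->.
  by rewrite (poweRyr (lt0r_neq0 q0)) gt0_mulye ?lte_fin.
pose A : set T := [set x | Z x = +oo].
have mA : measurable A.
  rewrite -[A]setTI; exact: (mZ measurableT [set +oo] (emeasurable_set1 _)).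
(* [fine] sends +oo to 0, so [z'] is 1 where [Z] is infinite. It is real, positive and at most [Z]:
   the integrals only decrease, and the right sides are unchanged almost everywhere. *)
pose z' x : R := (fine (Z x) + \1_A x)%R.
have z'fin x : Z x \is a fin_num -> (z' x)%:E = Z x.
  move=> Zx; rewrite /z' indicE memNset ?addr0 ?fineK//.
  by rewrite /A/= => Zoo; move: Zx; rewrite Zoo.
have z'Z x : (z' x)%:E <= Z x.
  have [Zx|] := boolP (Z x \is a fin_num); first by rewrite z'fin.
  by rewrite ge0_fin_numE// -leNgt leye_eq => /eqP ->; exact: leey.
have mz' : measurable_fun setT z'.
  apply: measurable_funD; first exact: measurableT_comp.
  exact: measurable_indic.
have z'0 x : (0 < z' x)%R.
  have [Zx|] := boolP (Z x \is a fin_num); first by rewrite -lte_fin z'fin.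
  rewrite ge0_fin_numE// -leNgt leye_eq => /eqP Zx.
  by rewrite /z' Zx/= add0r indicE mem_set.
have e'0 : (0 < e^-1)%R by rewrite invr_gt0.
exists (e^-1 + e^-1 `^ r)%R, z'; split => //.
  by rewrite addr_gt0 ?powR_gt0.
move: Zfin; apply: filterS => x Zx i Bx; split.
- apply: (@le_trans _ _ (\int[mu]_(y in B i) (Z y * (s y)%:E))).
    apply: ge0_le_integral => //.
    + by move=> y _; rewrite lee_fin mulr_ge0// ltW.
    + by apply/measurable_EFinP/measurable_funTS; exact: measurable_funM.
    + by apply: measurable_funTS; exact: emeasurable_funM.
    + by move=> y _; rewrite EFinM; apply: lee_wpmul2r => //; rewrite lee_fin ltW.
  apply: (le_trans (Z1 x i Bx)); rewrite z'fin//.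
  apply: lee_wpmul2r => //; apply: lee_wpmul2r => //.
  by rewrite lee_fin lerDl powR_ge0.
- apply: (@le_trans _ _ (\int[mu]_(y in B i) (Z y `^ r))).
    apply: ge0_le_integral => //.
    + by move=> y _; rewrite lee_fin powR_ge0.
    + apply/measurable_EFinP/measurable_funTS.
      exact: (measurableT_comp (measurable_powR _) mz').
    + by apply: measurable_funTS; exact: measurable_fun_poweR.
    + move=> y _; rewrite -poweR_EFin; apply: le_poweR => //; first exact: ltW.
      by rewrite lee_fin ltW.
  apply: (le_trans (Z2 x i Bx)); rewrite EFinM -(poweR_EFin (z' x)) z'fin//.
  apply: lee_wpmul2r.
    by rewrite mule_ge0 ?poweR_ge0// lee_fin invr_ge0 ltW.
  apply: lee_wpmul2r => //.
  by rewrite lee_fin lerDr ltW.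
Qed.

End weight_pair.

Lemma ler_trans_eq (R : numDomainType) (a b c e : R) : c = a -> b = e -> a <= b -> c <= e.
Proof. by move=> -> ->. Qed.

(** * Consequences of the A_q condition on one set *)

Section dual_pair.
Context d (T : measurableType d) (R : realType) (mu : {measure set T -> \bar R}).
Variables (v s : T -> R) (r : R).
Hypothesis r0 : 0 < r.
Hypotheses (mv : measurable_fun setT v) (ms : measurable_fun setT s).
Hypotheses (v0 : forall x, 0 < v x) (s0 : forall x, 0 < s x).
Hypothesis vs : forall x, v x * s x `^ r = 1.

(* Young's inequality [1 <= t^-r v + t s], integrated with [t = m / (2 S)] *)
Lemma le_dual_integrals (E : set T) (m V S : R) : measurable E ->
  0 < m -> 0 < S -> mu E = m%:E ->
  (\int[mu]_(x in E) (v x)%:E = V%:E)%E -> (\int[mu]_(x in E) (s x)%:E = S%:E)%E ->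
  (m / 2) `^ (r + 1) <= V * S `^ r.
Proof.
move=> mE m0 S0 Em EV ES.
pose t := m / (2 * S).
have t0 : 0 < t by rewrite divr_gt0 ?mulr_gt0.
have : m <= t `^ (- r) * V + t * S.
  apply: (le_cst_add_integral mE mv ms _ _ _ _ Em EV ES).
  - by move=> x; rewrite ltW.
  - by move=> x; rewrite ltW.
  - exact: powR_ge0.
  - exact: ltW.
  (* Since v = s^(-r), the two terms are (t s)^(-r) and t s, and one of them is at least 1. *)
  apply: aeW => x _; have [ts1|ts1] := leP 1 (t * s x).
    by rewrite (le_trans ts1)// lerDr mulr_ge0 ?powR_ge0 ?ltW.
  apply: (@le_trans _ _ (t `^ (- r) * v x)); last by rewrite lerDl mulr_ge0 ?ltW.
  rewrite powRN mulrC ler_pdivlMr ?powR_gt0// mul1r.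
  rewrite -[leRHS](@mulfK _ (s x `^ r)) ?gt_eqF ?powR_gt0// vs.
  rewrite ler_pdivlMr ?powR_gt0// -powRM ?(ltW t0) ?(ltW (s0 x))//.
  have ts0 : 0 <= t * s x by rewrite mulr_ge0 ?ltW.
  have -> : 1 = 1 `^ r :> R by rewrite powR1.
  by rewrite ge0_ler_powR ?nnegrE ?(ltW r0) ?ler01 ?(ltW ts1).
have -> : t * S = m / 2 by rewrite /t; field; rewrite gt_eqF.
rewrite -lerBlDr (_ : m - m / 2 = m / 2); last by field.
rewrite powRN [X in _ <= X -> _]mulrC ler_pdivlMr ?powR_gt0// => h.
have a0 : 0 <= m / 2 by rewrite divr_ge0// ltW.
have tS : (m / 2) `^ r = t `^ r * S `^ r.
  rewrite -powRM ?(ltW t0) ?(ltW S0)//; congr (_ `^ _).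
  by rewrite /t; field; rewrite gt_eqF.
rewrite powRD; last by rewrite gt_eqF// addr_gt0.
by rewrite powRr1// tS mulrAC ler_wpM2r ?powR_ge0// mulrC.
Qed.

(* [VB] and [SB] are the integrals over a set of measure [m2] containing [E]; the
   last hypothesis is the [A_q] bound on that set, with [q = r + 1]. *)
Lemma dual_doubling (E : set T) (A k m1 m2 VE VB SE SB : R) :
  measurable E -> 0 < A -> 0 < k -> 0 < m1 -> 0 < SE -> 0 < VE ->
  VE <= VB -> SE <= SB ->
  mu E = m1%:E -> m2 <= k * m1 -> 0 < m2 ->
  (\int[mu]_(x in E) (v x)%:E = VE%:E)%E -> (\int[mu]_(x in E) (s x)%:E = SE%:E)%E ->
  VB * SB `^ r <= A * m2 `^ (r + 1) ->
  let K := A * (2 * k) `^ (r + 1) in VB <= K * VE /\ SB <= K `^ r^-1 * SE.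
Proof.
move=> mE A0 k0 m10 SE0 VE0 VEB SEB Em mBk m20 EV ES AqB K.
have K0 : 0 < K by rewrite /K mulr_gt0// powR_gt0// mulr_gt0.
have SB0 : 0 < SB by exact: lt_le_trans SEB.
have VB0 : 0 < VB by exact: lt_le_trans VEB.
have r1 : 0 < r + 1 by rewrite addr_gt0.
(* The upper bound on the large set meets the lower bound of [le_dual_integrals] on [E]; m2 <= 2k
   (m1 / 2) explains the factor [2 * k]. Each conclusion then cancels one factor by monotonicity. *)
have h : VB * SB `^ r <= K * (VE * SE `^ r).
  rewrite (le_trans AqB)// /K -mulrA ler_wpM2l ?(ltW A0)//.
  apply: le_trans (ler_wpM2l (powR_ge0 _ _) (le_dual_integrals mE m10 SE0 Em EV ES)).
  rewrite -powRM ?mulr_ge0 ?divr_ge0 ?(ltW k0) ?(ltW m10)//.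
  rewrite ge0_ler_powR ?nnegrE ?(ltW r1) ?(ltW m20)//.
    by rewrite !mulr_ge0 ?invr_ge0 ?(ltW k0) ?(ltW m10).
  by rewrite (le_trans mBk)// le_eqVlt; apply/orP; left; apply/eqP; field.
clearbody K.
have SEBr : SE `^ r <= SB `^ r by rewrite ge0_ler_powR ?nnegrE ?(ltW r0) ?(ltW SE0) ?(ltW SB0).
split.
  rewrite -(ler_pM2r (powR_gt0 r SB0)) (le_trans h)// -mulrA.
  by rewrite ler_wpM2l ?(ltW K0)// ler_wpM2l ?(ltW VE0)//.
have : SB `^ r <= K * SE `^ r.
  rewrite -(ler_pM2l VB0) (le_trans h)// [leRHS]mulrCA ler_wpM2l ?(ltW K0)//.
  by rewrite ler_wpM2r ?powR_ge0.
move=> /(ge0_ler_powR (r := r^-1)).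
rewrite !nnegrE invr_ge0 (ltW r0) powR_ge0 mulr_ge0 ?powR_ge0 ?(ltW K0)// => /(_ isT isT isT).
rewrite powRM ?powR_ge0 ?(ltW K0)// -!powRrM divff ?gt_eqF// !powRr1// ltW//.
Qed.

Let vV x : (v x)^-1 = s x `^ r.
Proof. by rewrite -[RHS](mulKf (x := v x)) ?vs ?mulr1// gt_eqF. Qed.

(* Each of the two estimates in [P] bounds from below, on all of [E], the function
   integrated in the other one. *)
Lemma dual_pair_bigger (E : set T) (z : T -> R) (A C m V S : R) :
  measurable E -> measurable_fun setT z -> (forall x, 0 < z x) ->
  0 < A -> 0 < C -> 0 < m -> 0 < V -> 0 < S -> mu E = m%:E ->
  (\int[mu]_(x in E) (v x)%:E = V%:E)%E -> (\int[mu]_(x in E) (s x)%:E = S%:E)%E ->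
  V * S `^ r <= A * m `^ (r + 1) ->
  let P x := (\int[mu]_(y in E) (z y * s y)%:E <= (C * S * z x)%:E)%E /\
    (\int[mu]_(y in E) (z y `^ r)%:E <= (C * V * (z x `^ r / v x))%:E)%E in
  {ae mu, forall x, E x -> P x} ->
  let D := C `^ (r + 1) * A in
  forall x, E x -> P x ->
  (\int[mu]_(y in E) (z y * s y)%:E <= (D `^ r^-1 * m * (z x * s x))%:E)%E /\
  (\int[mu]_(y in E) (z y `^ r)%:E <= (D * m * z x `^ r)%:E)%E.
Proof.
move=> mE mz z0 A0 C0 m0 V0 S0 Em EV ES AqE P aeP D x Ex Px.
have r1 : 0 < r + 1 by rewrite addr_gt0.
have D0 : 0 < D by rewrite /D mulr_gt0// powR_gt0.
have mzs : measurable_fun setT (fun y => z y * s y) by exact: measurable_funM.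
have mzr : measurable_fun setT (fun y => z y `^ r).
  exact: (measurableT_comp (measurable_powR _) mz).
(* Both integrals are finite because the estimates hold at the single point [x] with real right
   sides. *)
have fin (I : \bar R) (c : R) : (0 <= I -> I <= c%:E -> I = (fine I)%:E)%E.
  move=> I0 Ic; rewrite fineK// ge0_fin_numE//; apply: le_lt_trans Ic _.
  exact: ltry.
set a := (\int[mu]_(y in E) _)%E in P aeP Px *.
set b := (\int[mu]_(y in E) _)%E in P aeP Px *.
have aE : (a = (fine a)%:E)%E.
  by apply: (fin _ _ _ Px.1); apply: integral_ge0 => y _; rewrite lee_fin mulr_ge0 ?ltW.
have bE : (b = (fine b)%:E)%E.
  by apply: (fin _ _ _ Px.2); apply: integral_ge0 => y _; rewrite lee_fin powR_ge0.
have a0 : 0 <= fine a.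
  by rewrite fine_ge0//; apply: integral_ge0 => y _; rewrite lee_fin mulr_ge0 ?ltW.
have b0 : 0 <= fine b.
  by rewrite fine_ge0//; apply: integral_ge0 => y _; rewrite lee_fin powR_ge0.
move: aE bE a0 b0; move: (fine a) (fine b) => ra rb aE bE a0 b0.
have CS0 : 0 < C * S by rewrite mulr_gt0.
have CV0 : 0 < C * V by rewrite mulr_gt0.
have PE y : P y -> ra <= C * S * z y /\ rb <= C * V * (z y * s y) `^ r.
  rewrite /P aE bE !lee_fin => -[h1 h2]; split => //.
  by rewrite powRM ?(ltW (z0 y)) ?(ltW (s0 y))// -vV.
have ha : (ra / (C * S)) `^ r * m <= rb.
  apply: (ae_cst_le_integral mE mzr _ _ Em bE).
  - by move=> y; exact: powR_ge0.
  - exact: powR_ge0.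
  move: aeP; apply: filterS => y h Ey; have [h1 _] := PE y (h Ey).
  rewrite ge0_ler_powR ?nnegrE ?(ltW r0) ?divr_ge0 ?(ltW CS0) ?(ltW (z0 y))//.
  by rewrite ler_pdivrMr// mulrC.
have hb : (rb / (C * V)) `^ r^-1 * m <= ra.
  apply: (ae_cst_le_integral mE mzs _ _ Em aE).
  - by move=> y; rewrite mulr_ge0 ?ltW.
  - exact: powR_ge0.
  move: aeP; apply: filterS => y h Ey; have [_ h2] := PE y (h Ey).
  have zs0 : 0 <= z y * s y by rewrite mulr_ge0 ?ltW.
  rewrite -[leRHS](powRr1 zs0) -(@mulfV _ r) ?gt_eqF// powRrM.
  rewrite ge0_ler_powR ?nnegrE ?invr_ge0 ?(ltW r0) ?powR_ge0 ?divr_ge0 ?(ltW CV0)//.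
  by rewrite ler_pdivrMr// mulrC.
have [h1 h2] := PE x Px.
have zs0 : 0 <= z x * s x by rewrite mulr_ge0 ?ltW.
have Cr : C `^ (r + 1) = C `^ r * C.
  by rewrite powRD ?powRr1 ?(ltW C0)//; rewrite gt_eqF.
have mr : m `^ (r + 1) = m `^ r * m.
  by rewrite powRD ?powRr1 ?(ltW m0)//; rewrite gt_eqF.
have CSr : (C * S) `^ r = C `^ r * S `^ r by rewrite powRM ?ltW.
have DE : D = C `^ r * C * A by rewrite /D Cr.
clearbody D; split; rewrite ?aE ?bE lee_fin.
(* [ha] and the second estimate at [x] give ra^r m <= (C S)^r C V (z s)^r, where the A_q condition
   replaces V S^r by A m^(r+1). The other conclusion eliminates [ra] in the same way. *)
- have : ra `^ r <= D * m `^ r * (z x * s x) `^ r.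
    rewrite -(ler_pM2r m0).
    have -> : ra `^ r = (ra / (C * S)) `^ r * (C * S) `^ r.
      rewrite -powRM ?divr_ge0 ?(ltW CS0)//; congr (_ `^ _).
      by rewrite divfK// gt_eqF.
    rewrite mulrAC; apply: le_trans (ler_wpM2r (powR_ge0 _ _) (le_trans ha h2)) _.
    rewrite CSr DE.
    have := ler_wpM2l (mulr_ge0 (mulr_ge0 (powR_ge0 C r) (ltW C0)) (powR_ge0 (z x * s x) r)) AqE.
    by rewrite mr; apply: ler_trans_eq; ring.
  move=> /(ge0_ler_powR (r := r^-1)).
  rewrite !nnegrE invr_ge0 (ltW r0) !mulr_ge0 ?powR_ge0 ?(ltW D0)// => /(_ isT isT isT).
  rewrite !powRM ?mulr_ge0 ?powR_ge0 ?(ltW D0) ?(ltW (z0 x)) ?(ltW (s0 x))//.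
  by rewrite -!powRrM divff ?gt_eqF// !powRr1// ltW.
- have : ((rb / (C * V)) `^ r^-1 * m) `^ r <= (C * S * z x) `^ r.
    rewrite ge0_ler_powR ?nnegrE ?(ltW r0) ?mulr_ge0 ?powR_ge0 ?(ltW m0)  ?(ltW C0) ?(ltW S0) ?(ltW (z0 x))//.
    exact: le_trans h1.
  rewrite powRM ?powR_ge0 ?(ltW m0)// -powRrM mulVf ?gt_eqF//.
  rewrite powRr1 ?divr_ge0 ?(ltW CV0)// powRM ?(ltW CS0) ?(ltW (z0 x))// CSr.
  rewrite mulrAC ler_pdivrMr// => h3.
  rewrite -(ler_pM2r (powR_gt0 r m0)) (le_trans h3)// DE.
  have := ler_wpM2l (mulr_ge0 (mulr_ge0 (powR_ge0 C r) (ltW C0)) (powR_ge0 (z x) r)) AqE.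
  by rewrite mr; apply: ler_trans_eq; ring.
Qed.

End dual_pair.

(** * Balls in a doubling metric space *)

Section doubling_balls.
Context {R : realType} {X : completeMetricType R}.
Variable mu : {measure set (borelType X) -> \bar R}.
Hypothesis mu_doubling : doubling mu.
Implicit Types (x y : X) (r e : R).

Local Notation mball x r := (ball x r : set (borelType X)).

Lemma in_ball x r y : ball x r y <-> mdist x y < r.
Proof. by rewrite ballEmdist. Qed.

(** [doubling] asserts positivity of the doubled ball, so it is applied at radius r / 2. *)
Lemma measure_ball_gt0_fin x r : 0 < r -> (0 < mu (ball x r) < +oo)%E.
Proof.
move=> r0; have [Cd [Cd1 h]] := mu_doubling.
have r20 : 0 < r / 2 by rewrite divr_gt0.
have [h1 h2 h3] := h x _ r20.
rewrite mulrCA divff// mulr1 in h1 h2.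
by rewrite h1/= (le_lt_trans h2 h3).
Qed.

Lemma doubling_expn : exists2 Cd : R, 0 < Cd & forall x r k, 0 < r ->
  (mu (ball x (2 ^+ k * r)) <= (Cd ^+ k)%:E * mu (ball x r))%E.
Proof.
have [Cd [Cd1 h]] := mu_doubling; have Cd0 : 0 < Cd by rewrite (lt_trans _ Cd1).
exists Cd => // x r + r0; elim => [|k ih]; first by rewrite !expr0 mul1r mul1e.
have [_ h2 _] := h x (2 ^+ k * r) (mulr_gt0 (exprn_gt0 _ (ltr0n _ 2)) r0).
rewrite exprS -mulrA (le_trans h2)// exprS EFinM -muleA.
by apply: lee_wpmul2l => //; rewrite lee_fin ltW.
Qed.

Lemma sub_ball x y r e : mdist x y + e <= r -> ball y e `<=` ball x r.
Proof.
move=> h z /in_ball yz; apply/in_ball.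
by rewrite (le_lt_trans (metric_triangle x y z))// (lt_le_trans _ h)// ltrD2l.
Qed.

Lemma le_measure_ball x y r e : mdist x y + e <= r ->
  (mu (ball y e) <= mu (ball x r))%E.
Proof.
move=> h; apply: le_measure; rewrite ?inE; try exact: measurable_mball.
exact: sub_ball.
Qed.

(* A maximal separated family would otherwise be infinite, giving infinitely
   many disjoint balls of measure bounded below inside one ball. *)
Lemma finite_net x0 (N e : R) : 0 < N -> 0 < e -> exists s : seq X,
  forall y, mdist x0 y < N -> exists2 x, x \in s & mdist x y < e.
Proof.
move=> N0 e0; apply: contrapT => /forallNP nonet.
have {}nonet (s : seq X) : exists y, mdist x0 y < N /\
    forall x, x \in s -> e <= mdist x y.
  apply: contrapT => /forallNP h; apply: (nonet s) => y yN.
  apply: contrapT => ne; apply: (h y); split => // x xs.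
  by rewrite leNgt; apply/negP => xy; apply: ne; exists x.
have [Cd Cd0 dbl] := doubling_expn.
have e20 : 0 < e / 2 by rewrite divr_gt0.
(* Doubling the radius e/2 [k] times reaches 2N, so the enlarged ball around any point of
   [ball x0 N] contains [ball x0 N]; this gives the uniform lower bound [c] for the small balls. *)
pose k := Num.bound (4 * N / e).
have kN : 2 * N <= 2 ^+ k * (e / 2).
  rewrite -ler_pdivrMr//.
  have -> : 2 * N / (e / 2) = 4 * N / e by field; rewrite gt_eqF.
  rewrite (le_trans (ltW (archi_boundP _)))//.
    by rewrite divr_ge0 ?mulr_ge0 ?(ltW N0) ?(ltW e0).
  by rewrite -natrX ler_nat ltnW// ltn_expl.
have /andP[B0 Boo] := measure_ball_gt0_fin x0 N0.
pose c := fine (mu (ball x0 N)) / Cd ^+ k.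
have c0 : 0 < c by rewrite divr_gt0 ?exprn_gt0// fine_gt0// B0.
have cle y : mdist x0 y < N -> (c%:E <= mu (ball y (e / 2)))%E.
  move=> yN; rewrite /c mulrC EFinM lee_pdivrMl ?exprn_gt0//.
  rewrite fineK; last by rewrite ge0_fin_numE// ltW.
  apply: le_trans (dbl y _ k e20); apply: le_measure_ball.
  rewrite metric_sym (le_trans _ kN)//; lra.
have big n : exists s : seq X, (forall x, x \in s -> mdist x0 x < N) /\
    ((n%:R * c)%:E <= mu (\big[setU/set0]_(x <- s) mball x (e / 2)))%E.
  elim: n => [|n [s [sN ih]]].
    by exists [::]; split => //; rewrite mul0r big_nil measure0.
  have [y [yN ys]] := nonet s; exists (y :: s); split.
    by move=> x; rewrite inE => /orP[/eqP->//|]; exact: sN.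
  rewrite big_cons measureU; [|exact: measurable_mball|..]; last 2 first.
  - by apply: bigsetU_measurable => x _; exact: measurable_mball.
  - rewrite -bigcup_seq; apply/seteqP; split => // z [/in_ball yz [x /= xs /in_ball xz]].
    have := ys x xs; rewrite leNgt => /negP; apply.
    rewrite (le_lt_trans (metric_triangle x z y))// (metric_sym z y).
    by rewrite (splitr e) ltrD.
  by rewrite -natr1 addrC mulrDl mul1r EFinD leeD// cle.
have {big} big n : (n%:R * c <= fine (mu (ball x0 (N + e))))%R.
  have [s [sN sc]] := big n.
  have /andP[B'0 B'oo] := measure_ball_gt0_fin x0 (addr_gt0 N0 e0).
  rewrite -lee_fin fineK ?ge0_fin_numE ?(ltW B'0)//.
  apply: (le_trans sc); apply: le_measure; rewrite ?inE.
  - by apply: bigsetU_measurable => x _; exact: measurable_mball.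
  - exact: measurable_mball.
  rewrite -bigcup_seq => z [x /= xs]; apply: sub_ball.
  have := sN x xs; lra.
have := archi_boundP (divr_ge0 (fine_ge0 (measure_ge0 mu (mball x0 (N + e)))) (ltW c0)).
by rewrite ltr_pdivrMr// ltNge big.
Qed.

(** The nets of all balls of radius [N.+1] about [x0] at all scales 1 / k.+1 are countably many
    finite lists; [pickle] enumerates their entries. *)
Lemma dense_sequence (x0 : X) : exists D : nat -> X,
  forall x e, 0 < e -> exists n, mdist x (D n) < e.
Proof.
have net (Nk : nat * nat) : exists s : seq X, forall y, mdist x0 y < Nk.1.+1%:R ->
    exists2 x, x \in s & mdist x y < Nk.2.+1%:R^-1.
  by apply: finite_net => //; rewrite invr_gt0.
have [s hs] := choice net.
pose D (n : nat) : X :=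
  if unpickle n is Some (N, k, j) then nth x0 (s (N, k)) j else x0.
exists D => x e e0.
pose N := Num.bound (mdist x0 x); pose k := Num.bound e^-1.
have [|y ys yx] := hs (N, k) x.
  by rewrite (lt_trans (archi_boundP (mdist_ge0 _ _)))// ltr_nat.
exists (pickle (N, k, index y (s (N, k)))).
rewrite /D pickleK nth_index// metric_sym (lt_trans yx)//= invf_plt ?posrE//.
rewrite (lt_trans (archi_boundP _)) ?ltr_nat//.
by rewrite invr_ge0 ltW.
Qed.

(** Dense centres and rational radii: a centre within e of [x] and a radius between 2e and 3e give
    the inclusions, hence the 4. The default radius 1 keeps every member of the family a genuine
    ball. *)
Lemma countable_balls (x0 : X) : exists c : nat -> X, exists r : nat -> R,
  (forall i, 0 < r i) /\
  forall x e, 0 < e -> exists i,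
    ball x e `<=` ball (c i) (r i) /\ ball (c i) (r i) `<=` ball x (4 * e).
Proof.
have [D hD] := dense_sequence x0.
pose c (i : nat) : X := if @unpickle (nat * rat)%type i is Some (n, q) then D n else x0.
pose r (i : nat) : R := if @unpickle (nat * rat)%type i is Some (n, q) then
  (if 0 < ratr q :> R then ratr q else 1) else 1.
exists c, r; split => [i|x e e0].
  by rewrite /r; case: unpickle => [[n q]|//]; case: ifPn.
have [n xn] := hD x e e0.
have [q] : exists q : rat, ratr q \in `](2 * e), (3 * e)[.
  by apply: rat_in_itvoo; lra.
rewrite in_itv/= => /andP[q2 q3].
have q0 : 0 < ratr q :> R by lra.
exists (pickle (n, q)); rewrite /c /r !pickleK q0; split; apply: sub_ball.
  by rewrite metric_sym; lra.
lra.
Qed.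

(** Greedy choice: keep a ball of largest radius, drop those that meet it, which lie in its triple,
    and recurse on the shorter list of the others. *)
Lemma vitali_finite_balls (c : nat -> X) (r : nat -> R) :
  (forall i, 0 < r i) ->
  vitali_covering (fun i => ball (c i) (r i)) (fun i => ball (c i) (3 * r i)).
Proof.
move=> r0 s; have [n sn] := ubnP (size s); elim: n s sn => // n ih s sn.
have [->|s0] := eqVneq s [::]; first by exists [::]; split => // i j.
have [j js jmax] : exists2 j, j \in s & forall i, i \in s -> r i <= r j.
  move: s0 {sn}; elim: s => // a s IH _; have [->|s0] := eqVneq s [::].
    by exists a; rewrite ?mem_head// => i; rewrite inE => /eqP ->.
  have [j js jm] := IH s0; have [raj|rja] := leP (r a) (r j).
    by exists j; rewrite ?inE ?js ?orbT// => i /[!inE]/orP[/eqP->//|/jm].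
  exists a; rewrite ?mem_head// => i /[!inE]/orP[/eqP->//|/jm h].
  by rewrite (le_trans h)// ltW.
pose B i := ball (c i) (r i).
pose s' := [seq i <- s | `[< B i `&` B j = set0 >]].
have Bj : B j (c j) by apply: ballxx.
have js' : j \notin s'.
  rewrite mem_filter; apply/negP => /andP[/asboolP]; rewrite setIid => Bj0 _.
  by move: Bj; rewrite Bj0.
have [t [ut ts' tB cov]] : exists t : seq nat, [/\ uniq t, {subset t <= s'},
    trivIset [set` t] B & forall i, i \in s' -> exists2 j, j \in t &
        ball (c i) (r i) `<=` ball (c j) (3 * r j)].
  apply: ih; rewrite -ltnS (leq_trans _ sn)// ltnS size_filter.
  rewrite -(count_predC (fun i => `[< B i `&` B j = set0 >]) s).
  rewrite -[X in (X < _)%N]addn0 ltn_add2l -has_count; apply/hasP; exists j => //=.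
  by move: js'; rewrite mem_filter js andbT.
have tj i : i \in t -> B i `&` B j = set0.
  by move=> /ts'; rewrite mem_filter => /andP[/asboolP].
exists (j :: t); split.
- by rewrite /= ut andbT; apply: contra js'; exact: ts'.
- move=> i /[!inE]/orP[/eqP->//|/ts']; by rewrite mem_filter => /andP[].
- move=> i k /= /[!inE] /orP[/eqP->|it] /orP[/eqP->|kt]//.
  + by rewrite setIC tj// => -[].
  + by rewrite tj// => -[].
  + exact: tB.
- move=> i iS; have [ij|/set0P[z [/in_ball iz /in_ball jz]]] := eqVneq (B i `&` B j) set0.
    have [|k kt sub] := cov i; first by rewrite mem_filter iS andbT; exact/asboolP.
    by exists k => //; rewrite inE kt orbT.
  exists j; first exact: mem_head.
  apply: sub_ball.
  have := metric_triangle (c j) z (c i); rewrite (metric_sym z (c i)).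
  have := jmax i iS; lra.
Qed.

End doubling_balls.

(** * From the countable family to all balls *)

Section factorization.
Context {R : realType} {X : completeMetricType R}.
Variable mu : {measure set (borelType X) -> \bar R}.
Hypothesis mu_doubling : doubling mu.
Variables (v s : borelType X -> R) (r A : R).
Hypotheses (r0 : 0 < r) (A0 : 0 < A).
Hypotheses (mv : measurable_fun setT v) (ms : measurable_fun setT s).
Hypotheses (v0 : forall x, 0 < v x) (s0 : forall x, 0 < s x).
Hypothesis vs : forall x, v x * s x `^ r = 1.
Hypothesis vsA : forall (x : X) (e : R), 0 < e -> exists m V S : R,
  [/\ [/\ 0 < m, 0 < V & 0 < S], mu (ball x e) = m%:E,
      (\int[mu]_(y in ball x e) (v y)%:E = V%:E)%E,
      (\int[mu]_(y in ball x e) (s y)%:E = S%:E)%E &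
      V * S `^ r <= A * m `^ (r + 1)].

(** A ball lies in some [B i] contained in its fourfold enlargement, so estimates on [B i] pass to
    it with one more factor Cd^2. The null set is that of [weight_pair_bigger], common to all
    balls. *)
Lemma dual_pair_factor : exists D : R, exists z : borelType X -> R,
  [/\ 0 < D, measurable_fun setT z, forall x, 0 < z x &
   {ae mu, forall x, forall (y : X) (e : R), 0 < e -> ball y e x ->
     (\int[mu]_(t in ball y e) (z t * s t)%:E <= D%:E * mu (ball y e) * (z x * s x)%:E)%E /\
     (\int[mu]_(t in ball y e) (z t `^ r)%:E <= D%:E * mu (ball y e) * (z x `^ r)%:E)%E}].
Proof.
have [[x0]|nX] := pselect (inhabited X); last first.
  exists 1, (cst 1); split => //.
  by apply: aeW => x; exfalso; apply: nX; exact: inhabits x.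
have [c [rad [rad0 famP]]] := countable_balls mu_doubling x0.
have [Cd Cd0 dbl] := doubling_expn mu_doubling.
pose B i : set (borelType X) := ball (c i) (rad i).
pose B3 i : set (borelType X) := ball (c i) (3 * rad i).
have mB i : measurable (B i) by exact: measurable_mball.
have mB3 i : measurable (B3 i) by exact: measurable_mball.
have rad30 i : 0 < 3 * rad i by rewrite mulr_gt0.
have BB3 i : B i `<=` B3 i.
  by apply: sub_ball; rewrite mdistxx add0r; have := rad0 i; lra.
have muB4 x e : 0 < e -> (mu (ball x (4 * e)) <= (Cd ^+ 2)%:E * mu (ball x e))%E.
  by move=> e0; have := dbl x e 2%N e0; rewrite (_ : 2 ^+ 2 = 4 :> R)//; rewrite expr2 -natrM.
have muB3 i : (mu (B3 i) <= (Cd ^+ 2)%:E * mu (B i))%E.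
  apply: le_trans (muB4 _ _ (rad0 i)); apply: le_measure_ball.
  by rewrite mdistxx add0r; have := rad0 i; lra.
(* The constant of [dual_doubling] for k = Cd^2, since a tripled ball lies in the quadrupled one;
   [K] adds the constants obtained for [v] and for [s]. *)
pose K0 := A * (2 * Cd ^+ 2) `^ (r + 1).
have K00 : 0 < K0 by rewrite mulr_gt0// powR_gt0// mulr_gt0// exprn_gt0.
pose K := K0 + K0 `^ r^-1.
have KK : 0 < K by rewrite addr_gt0// powR_gt0.
have dd i : (\int[mu]_(y in B3 i) (v y)%:E <= K%:E * \int[mu]_(y in B i) (v y)%:E)%E /\
            (\int[mu]_(y in B3 i) (s y)%:E <= K%:E * \int[mu]_(y in B i) (s y)%:E)%E.
  have [m [V [S [[m0 V0 S0] Em EV ES _]]]] := vsA (c i) (rad0 i).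
  have [m' [V' [S' [[m'0 V'0 S'0] Em' EV' ES' hA]]]] := vsA (c i) (rad30 i).
  have VV' : V <= V'.
    rewrite -lee_fin -EV -EV'; apply: ge0_subset_integral => //.
    - exact: mB.
    - exact: mB3.
    - by apply/measurable_EFinP/measurable_funTS.
    - by move=> y _; rewrite lee_fin ltW.
    - exact: BB3.
  have SS' : S <= S'.
    rewrite -lee_fin -ES -ES'; apply: ge0_subset_integral => //.
    - exact: mB.
    - exact: mB3.
    - by apply/measurable_EFinP/measurable_funTS.
    - by move=> y _; rewrite lee_fin ltW.
    - exact: BB3.
  have mm' : m' <= Cd ^+ 2 * m.
    by rewrite -lee_fin EFinM -Em -Em'; exact: muB3.
  have := dual_doubling r0 mv ms v0 s0 vs (mB i) A0 (exprn_gt0 2 Cd0) m0 S0 V0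
    VV' SS' Em mm' m'0 EV ES hA.
  rewrite /= -/K0 => -[h1 h2]; rewrite /B3 /B EV EV' ES ES' -!EFinM !lee_fin; split.
    by rewrite (le_trans h1)// ler_wpM2r ?(ltW V0)// lerDl powR_ge0.
  by rewrite (le_trans h2)// ler_wpM2r ?(ltW S0)// lerDr ltW.
have cover x : exists i, B i x /\ B 0%N `<=` B i.
  pose e := mdist x (c 0%N) + rad 0%N.
  have e0 : 0 < e by rewrite ltr_wpDl// mdist_ge0.
  have [i [h1 h2]] := famP x e e0.
  exists i; split; first by apply: h1; exact: ballxx.
  by apply: subset_trans h1; exact: sub_ball.
have VB i : (0 < density mu mv (fun x => ltW (v0 x)) (B i) < +oo)%E.
  have [m [V [S [[m0 V0 S0] Em EV ES _]]]] := vsA (c i) (rad0 i).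
  by rewrite /density /B EV lte_fin V0 ltry.
have SB i : (0 < density mu ms (fun x => ltW (s0 x)) (B i) < +oo)%E.
  have [m [V [S [[m0 V0 S0] Em EV ES _]]]] := vsA (c i) (rad0 i).
  by rewrite /density /B ES lte_fin S0 ltry.
have [C [z [C0 mz z0 aez]]] := weight_pair_bigger r0 vs mB mB3 KK VB SB
  (fun i => (dd i).1) (fun i => (dd i).2) (vitali_finite_balls c rad0) cover.
pose D0 := C `^ (r + 1) * A.
have D00 : 0 < D0 by rewrite mulr_gt0// powR_gt0.
pose D := (D0 `^ r^-1 + D0) * Cd ^+ 2.
exists D, z; split => //.
  by rewrite mulr_gt0 ?exprn_gt0// addr_gt0// powR_gt0.
have mzs : measurable_fun setT (fun y => z y * s y) by exact: measurable_funM.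
have mzr : measurable_fun setT (fun y => z y `^ r).
  exact: (measurableT_comp (measurable_powR _) mz).
move: (aez); apply: filterS => x hx y e e0 xy.
have [i [h1 h2]] := famP y e e0.
have Bx : B i x by exact: h1.
have [m [V [S [[m0 V0 S0] Em EV ES hA]]]] := vsA (c i) (rad0 i).
have mB4 : (m%:E <= (Cd ^+ 2)%:E * mu (ball y e))%E.
  rewrite -Em; apply: le_trans (muB4 _ _ e0); apply: le_measure; rewrite ?inE//.
  - exact: mB.
  - exact: measurable_mball.
have hP t : (forall j, B j t ->
     (\int[mu]_(y in B j) (z y * s y)%:E <= C%:E * density mu ms (fun x => ltW (s0 x)) (B j) * (z t)%:E)%E /\
     (\int[mu]_(y in B j) (z y `^ r)%:E <= C%:E * density mu mv (fun x => ltW (v0 x)) (B j) * (z t `^ r / v t)%:E)%E) ->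
   B i t -> (\int[mu]_(y in B i) (z y * s y)%:E <= (C * S * z t)%:E)%E /\
    (\int[mu]_(y in B i) (z y `^ r)%:E <= (C * V * (z t `^ r / v t))%:E)%E.
  by move=> /(_ i) h /h; rewrite /density /B EV ES -!EFinM.
have [k1 k2] := dual_pair_bigger r0 ms v0 s0 vs (mB i) mz z0 A0 C0 m0 V0 S0 Em EV ES hA
  (filterS hP aez) Bx (hP x hx Bx).
have zs0 : 0 <= z x * s x by rewrite mulr_ge0 ?ltW.
rewrite -/D0 in k1 k2; rewrite /D; clearbody D0; split.
- apply: (@le_trans _ _ (\int[mu]_(t in B i) (z t * s t)%:E)%E).
    apply: ge0_subset_integral => //.
    + exact: measurable_mball.
    + by apply/measurable_EFinP/measurable_funTS.
    + by move=> t _; rewrite lee_fin mulr_ge0 ?ltW.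
  rewrite (le_trans k1)// EFinM; apply: lee_wpmul2r; first by rewrite lee_fin.
  rewrite !EFinM -muleA; apply: lee_pmul => //.
  + by rewrite lee_fin powR_ge0.
  + by rewrite lee_fin ltW.
  + by rewrite lee_fin lerDl ltW.
- apply: (@le_trans _ _ (\int[mu]_(t in B i) (z t `^ r)%:E)%E).
    apply: ge0_subset_integral => //.
    + exact: measurable_mball.
    + by apply/measurable_EFinP/measurable_funTS.
    + by move=> t _; rewrite lee_fin powR_ge0.
  rewrite (le_trans k2)// EFinM; apply: lee_wpmul2r; first by rewrite lee_fin powR_ge0.
  rewrite !EFinM -muleA; apply: lee_pmul => //.
  + by rewrite lee_fin ltW.
  + by rewrite lee_fin ltW.
  + by rewrite lee_fin lerDr powR_ge0.
Qed.

End factorization.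

(** * Weight classes *)

Section weight_balls.
Context {R : realType} {X : completeMetricType R}.
Variable mu : {measure set (borelType X) -> \bar R}.
Hypothesis mu_doubling : doubling mu.
Implicit Types (x : X) (e : R).

Lemma ae_mrestr (D : set (borelType X)) (mD : measurable D)
    (P : borelType X -> Prop) :
  {ae mrestr mu mD, forall t, P t} <-> {ae mu, forall t, D t -> P t}.
Proof.
split=> -[N [mN N0 sub]].
  exists (N `&` D); split => //; first exact: measurableI.
  by move=> t /= /not_implyP[Dt Pt]; split => //; exact: sub.
exists (N `|` ~` D); split.
- by apply: measurableU => //; exact: measurableC.
- rewrite /mrestr setIUl setICl setU0.
  by apply: (subset_measure0 _ mN _ N0); [exact: measurableI|exact: subIsetl].
- move=> t /= Pt; have [Dt|] := pselect (D t); last by right.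
  by left; apply: sub => /(_ Dt).
Qed.

Lemma ess_inf_ballP x e (f : X -> R) (c : \bar R) :
  (c <= ess_inf_ball mu x e f)%E <->
  {ae mu, forall t : borelType X, ball x e t -> (c <= (f t)%:E)%E}.
Proof.
rewrite -(ae_mrestr (measurable_mball x e) (fun t => (c <= (f t)%:E)%E)).
by split=> [/ess_infP//|h]; apply/ess_infP.
Qed.

Lemma ess_sup_ballP x e (f : X -> R) (c : \bar R) :
  (ess_sup_ball mu x e f <= c)%E <->
  {ae mu, forall t : borelType X, ball x e t -> ((f t)%:E <= c)%E}.
Proof.
rewrite -(ae_mrestr (measurable_mball x e) (fun t => ((f t)%:E <= c)%E)).
by split=> [/ess_supP//|h]; apply/ess_supP.
Qed.

Lemma measure_ballE x e : 0 < e -> exists2 m : R, 0 < m & mu (ball x e) = m%:E.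
Proof.
move=> e0; have /andP[m0 moo] := measure_ball_gt0_fin mu_doubling x e0.
have mE : mu (ball x e) = (fine (mu (ball x e)))%:E.
  by rewrite fineK// ge0_fin_numE// ltW.
by exists (fine (mu (ball x e))); rewrite // -lte_fin -mE.
Qed.

Lemma avgE x e (f : X -> R) (m I : R) : 0 < m -> mu (ball x e) = m%:E ->
  (\int[mu]_(y in ball x e) (f y)%:E = I%:E)%E -> avg mu x e f = (I / m)%:E.
Proof. by move=> m0 Em EI; rewrite /avg Em EI inver gt_eqF// -EFinM mulrC. Qed.

Lemma avg_pinfty x e (f : X -> R) (m : R) : 0 < m -> mu (ball x e) = m%:E ->
  (\int[mu]_(y in ball x e) (f y)%:E = +oo)%E -> (avg mu x e f = +oo)%E.
Proof.
by move=> m0 Em EI; rewrite /avg Em EI inver gt_eqF// gt0_muley// lte_fin invr_gt0.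
Qed.

Lemma compact_sub_ball (K : set X) x : compact K -> exists2 e, 0 < e & K `<=` ball x e.
Proof.
rewrite compact_cover => cK.
have [n _|y Ky|D _ KD] := cK nat setT (fun n => ball x n.+1%:R).
- exact: open_mball.
- exists (Num.bound (mdist x y)) => //; apply/in_ball.
  by rewrite (lt_trans (archi_boundP (mdist_ge0 _ _)))// ltr_nat.
(* The sum of the radii of the finite subcover bounds each of them. *)
exists (\sum_(n <- finmap.enum_fset D) n.+1)%N.+1%:R => // y /KD[n /= nD /in_ball xy].
apply/in_ball; rewrite (lt_le_trans xy)// ler_nat ltnW// ltnS.
by rewrite (big_rem n)//= leq_addr.
Qed.

Lemma L1loc_balls (f : X -> R) : measurable_fun [set: borelType X] (f : borelType X -> R) ->
  (forall y, 0 <= f y) ->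
  (forall x e, 0 < e -> (\int[mu]_(y in ball x e) (f y)%:E < +oo)%E) ->
  L1loc mu f.
Proof.
move=> mf f0 fin; split=> // K cK.
have mK : measurable (K : set (borelType X)).
  rewrite -[K]setCK; apply: measurableC; apply: sub_sigma_algebra.
  by apply: closed_openC; apply: compact_closed => //; exact: metric_hausdorff.
have mfE : measurable_fun setT (EFin \o (f : borelType X -> R)) by apply/measurable_EFinP.
apply/integrableP; split; first exact: measurable_funTS.
have [->|/set0P[x Kx]] := eqVneq K set0; first by rewrite integral_set0.
have [e e0 Ke] := compact_sub_ball x cK.
apply: le_lt_trans (fin x e e0).
under eq_integral do rewrite /= ger0_norm//.
apply: ge0_subset_integral => //.
- exact: measurable_mball.
- exact: measurable_funTS.
- by move=> y _; rewrite lee_fin.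
Qed.

Lemma pos_constant (f g : X -> R -> \bar R) :
  (forall x e, 0 < e -> (0 <= g x e)%E) ->
  (exists C : R, forall x e, 0 < e -> (f x e <= C%:E * g x e)%E) ->
  exists2 C : R, 0 < C & forall x e, 0 < e -> (f x e <= C%:E * g x e)%E.
Proof.
move=> g0 [C h]; exists (Num.max C 1); first by rewrite lt_max ltr01 orbT.
move=> x e e0; apply: le_trans (h x e e0) _; apply: lee_wpmul2r; first exact: g0.
by rewrite lee_fin le_max lexx.
Qed.

Lemma avg_ge0 x e (f : X -> R) : (forall y, 0 <= f y) -> (0 <= avg mu x e f)%E.
Proof.
move=> f0; rewrite /avg mule_ge0 ?inve_ge0 ?integral_ge0// => y _.
by rewrite lee_fin.
Qed.

Variable p : R.
Hypothesis p1 : 1 < p.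

Lemma measurable_powR_weight (f : X -> R) a :
  measurable_fun [set: borelType X] (f : borelType X -> R) ->
  measurable_fun [set: borelType X] (fun y : borelType X => f y `^ a).
Proof. by move=> mf; exact: (measurableT_comp (measurable_powR _) mf). Qed.

Lemma weight_integral_gt0 (w : X -> R) a x e : weight mu w -> 0 < e ->
  (0 < \int[mu]_(y in ball x e) (w y `^ a)%:E)%E.
Proof.
move=> [w0 [mw _] aew] e0; apply: ae_gt0_integral.
- exact: measurable_mball.
- exact: measurable_powR_weight.
- by move=> y; exact: powR_ge0.
- by move: aew; apply: filterS => y; exact: powR_gt0.
- by case/andP: (measure_ball_gt0_fin mu_doubling x e0).
Qed.

Lemma weight_integral1_gt0 (w : X -> R) x e : weight mu w -> 0 < e ->
  (0 < \int[mu]_(y in ball x e) (w y)%:E)%E.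
Proof.
move=> ww e0; have := @weight_integral_gt0 w 1 x e ww e0.
case: ww => w0 _ _.
by under eq_integral do rewrite powRr1//.
Qed.

(** Both averages are positive, because a weight is positive a.e. on a ball of positive measure; a
    finite product therefore rules out an infinite factor, and the condition becomes one between
    real numbers. *)
Lemma Ap_bound (w : X -> R) : in_Ap mu p w -> exists2 A : R, 0 < A &
  forall x e, 0 < e -> exists m W S : R,
    [/\ [/\ 0 < m, 0 < W & 0 < S], mu (ball x e) = m%:E,
        (\int[mu]_(y in ball x e) (w y)%:E = W%:E)%E,
        (\int[mu]_(y in ball x e) (w y `^ (- (p - 1)^-1))%:E = S%:E)%E &
        W / m * (S / m) `^ (p - 1) <= A].
Proof.
move=> [ww]; set E := (X in ereal_sup X) => supE.
have p10 : 0 < p - 1 by rewrite subr_gt0.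
have [A A0 EA] : exists2 A : R, 0 < A & forall t, E t -> (t <= A%:E)%E.
  have h t : E t -> (t <= ereal_sup E)%E by move=> ?; exact: ereal_sup_ubound.
  move: supE h; case: (ereal_sup E) => [A _ h|//|_ h].
    exists (Num.max A 1); first by rewrite lt_max ltr01 orbT.
    by move=> t /h /le_trans; apply; rewrite lee_fin le_max lexx.
  by exists 1 => // t /h; rewrite leeNy_eq => /eqP ->; exact: leNye.
exists A => // x e e0; have [m m0 Em] := measure_ballE x e0.
have : (avg mu x e w * (avg mu x e (fun y => (w y `^ (- (p - 1)^-1))%R)) `^ (p - 1) <= A%:E)%E.
  by apply: EA; exists x => //; exists e.
have := weight_integral1_gt0 x ww e0; have := weight_integral_gt0 (- (p - 1)^-1) x ww e0.
case EI : (\int[mu]_(y in ball x e) (w y)%:E)%E => [W| |//]; last first.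
  case EJ : (\int[mu]_(y in ball x e) (w y `^ (- (p - 1)^-1))%:E)%E => [S| |//] S0 _.
    rewrite lte_fin in S0; rewrite (avg_pinfty m0 Em EI) (avgE m0 Em EJ) gt0_mulye ?leye_eq//.
    by rewrite poweR_gt0// lte_fin divr_gt0 -?lte_fin.
  rewrite (avg_pinfty m0 Em EI) (avg_pinfty m0 Em EJ) poweRyr ?gt_eqF//.
case EJ : (\int[mu]_(y in ball x e) (w y `^ (- (p - 1)^-1))%:E)%E => [S| |//]; last first.
  move=> _ W0; rewrite (avgE m0 Em EI) (avg_pinfty m0 Em EJ) poweRyr ?gt_eqF//.
  by rewrite gt0_muley ?leye_eq// lte_fin divr_gt0.
rewrite !lte_fin => S0 W0; rewrite (avgE m0 Em EI) (avgE m0 Em EJ).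
by rewrite poweR_EFin -EFinM lee_fin => h; exists m, W, S.
Qed.

Lemma Ap_intro (w : X -> R) (A : R) : weight mu w ->
  (forall x e, 0 < e -> exists m W S : R,
    [/\ 0 < m, mu (ball x e) = m%:E,
        (\int[mu]_(y in ball x e) (w y)%:E = W%:E)%E,
        (\int[mu]_(y in ball x e) (w y `^ (- (p - 1)^-1))%:E = S%:E)%E &
        W / m * (S / m) `^ (p - 1) <= A]) -> in_Ap mu p w.
Proof.
move=> ww h; split => //; apply: (@le_lt_trans _ _ A%:E); last exact: ltry.
apply: ub_ereal_sup => _ [x _ [e e0 <-]].
have [m [W [S [m0 Em EW ES hA]]]] := h x e e0.
by rewrite (avgE m0 Em EW) (avgE m0 Em ES) poweR_EFin -EFinM lee_fin.
Qed.

Lemma RH_bound s (w : X -> R) : 0 < s -> in_RH mu s w -> exists2 C : R, 0 < C &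
  forall x e (m W : R), 0 < e -> 0 < m -> mu (ball x e) = m%:E ->
    (\int[mu]_(y in ball x e) (w y)%:E = W%:E)%E -> exists V : R,
    [/\ 0 < V, (\int[mu]_(y in ball x e) (w y `^ s)%:E = V%:E)%E &
        (V / m) `^ s^-1 <= C * (W / m)].
Proof.
move=> s0 [ww] /pos_constant[x e e0|C C0 h].
  by apply: avg_ge0; case: ww.
exists C => // x e m W e0 m0 Em EW; have := h x e e0.
rewrite (avgE m0 Em EW); have := weight_integral_gt0 s x ww e0.
case EV : (\int[mu]_(y in ball x e) (w y `^ s)%:E)%E => [V| |//].
  rewrite (avgE m0 Em EV) poweR_EFin -EFinM lee_fin lte_fin => V0 VW.
  by exists V.
by rewrite (avg_pinfty m0 Em EV) poweRyr ?invr_eq0 ?gt_eqF.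
Qed.

Lemma RH_intro s (w : X -> R) (C : R) : weight mu w ->
  (forall x e, 0 < e -> exists m W V : R,
    [/\ 0 < m, mu (ball x e) = m%:E,
        (\int[mu]_(y in ball x e) (w y)%:E = W%:E)%E,
        (\int[mu]_(y in ball x e) (w y `^ s)%:E = V%:E)%E &
        (V / m) `^ s^-1 <= C * (W / m)]) -> in_RH mu s w.
Proof.
move=> ww h; split => //; exists C => x e e0.
have [m [W [V [m0 Em EW EV hC]]]] := h x e e0.
by rewrite (avgE m0 Em EW) (avgE m0 Em EV) poweR_EFin -EFinM lee_fin.
Qed.

(** The essential infimum is a positive real: +oo would be below a real value of [w] at some point,
    -oo would make the average negative, and c <= 0 contradicts a positive average. *)
Lemma A1_bound (w : X -> R) : in_A1 mu w -> exists2 C : R, 0 < C &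
  forall x e, 0 < e -> exists m W c : R,
    [/\ [/\ 0 < m, 0 < W & 0 < c], mu (ball x e) = m%:E,
        (\int[mu]_(y in ball x e) (w y)%:E = W%:E)%E,
        {ae mu, forall t : borelType X, ball x e t -> c <= w t} & W / m <= C * c].
Proof.
move=> [ww] /pos_constant[x e e0|C C0 h].
  by apply/ess_inf_ballP; apply: aeW => t _; rewrite lee_fin; case: ww.
exists C => // x e e0; have [m m0 Em] := measure_ballE x e0.
have := h x e e0; have := (ess_inf_ballP x e w (ess_inf_ball mu x e w)).1 (lexx _).
have := weight_integral1_gt0 x ww e0.
have B0 : (0 < mu (ball x e))%E by rewrite Em lte_fin.
case Ec : (ess_inf_ball mu x e w) => [c| |].
- case EW : (\int[mu]_(y in ball x e) (w y)%:E)%E => [W| |//].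
    rewrite (avgE m0 Em EW) -EFinM lee_fin lte_fin => W0 aec Wc.
    exists m, W, c; split => //; split => //.
    by rewrite -(pmulr_rgt0 _ C0) (lt_le_trans _ Wc)// divr_gt0.
  by rewrite (avg_pinfty m0 Em EW).
- move=> _ aec _.
  have [t [_]] := ae_exists (measurable_mball x e) B0 aec.
  by rewrite leye_eq.
- move=> W0 _; rewrite gt0_muleNy// leeNy_eq => /eqP EN.
  have : (0 <= avg mu x e w)%E by apply: avg_ge0; case: ww.
  by rewrite EN.
Qed.

Lemma A1_intro (w : X -> R) (C : R) : weight mu w -> 0 < C ->
  (forall x e, 0 < e -> exists m W : R,
    [/\ 0 < m, mu (ball x e) = m%:E,
        (\int[mu]_(y in ball x e) (w y)%:E = W%:E)%E &
        {ae mu, forall t : borelType X, ball x e t -> W / m <= C * w t}]) ->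
  in_A1 mu w.
Proof.
move=> ww C0 h; split => //; exists C => x e e0.
have [m [W [m0 Em EW hC]]] := h x e e0.
rewrite (avgE m0 Em EW) -lee_pdivrMl// -EFinM; apply/ess_inf_ballP.
move: hC; apply: filterS => t /[apply].
by rewrite lee_fin ler_pdivrMl.
Qed.

Lemma RHoo_bound (w : X -> R) : in_RHoo mu w -> exists2 C : R, 0 < C &
  forall x e (m W : R), 0 < e -> 0 < m -> mu (ball x e) = m%:E ->
    (\int[mu]_(y in ball x e) (w y)%:E = W%:E)%E ->
    {ae mu, forall t : borelType X, ball x e t -> w t <= C * (W / m)}.
Proof.
move=> [ww] /pos_constant[x e e0|C C0 h].
  by apply: avg_ge0; case: ww.
exists C => // x e m W e0 m0 Em EW; have := h x e e0.
rewrite (avgE m0 Em EW) -EFinM => /ess_sup_ballP.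
by apply: filterS => t /[apply]; rewrite lee_fin.
Qed.

Lemma RHoo_intro (w : X -> R) (C : R) : weight mu w ->
  (forall x e, 0 < e -> exists m W : R,
    [/\ 0 < m, mu (ball x e) = m%:E,
        (\int[mu]_(y in ball x e) (w y)%:E = W%:E)%E &
        {ae mu, forall t : borelType X, ball x e t -> w t <= C * (W / m)}]) ->
  in_RHoo mu w.
Proof.
move=> ww h; split => //; exists C => x e e0.
have [m [W [m0 Em EW hC]]] := h x e e0.
rewrite (avgE m0 Em EW) -EFinM; apply/ess_sup_ballP.
by move: hC; apply: filterS => t /[apply]; rewrite lee_fin.
Qed.

End weight_balls.

(** * Powers, products and factors of weights *)

Section classes.
Context {R : realType} {X : completeMetricType R}.
Variable mu : {measure set (borelType X) -> \bar R}.
Hypothesis mu_doubling : doubling mu.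
Implicit Types (x : X) (e : R).

(** Let [l] be the L^s average of [f]. The hypothesis gives l <= D^(1/s) f almost everywhere on the
    ball. With avg f <= 2 l this is the [A_1] condition; integrated over the ball it is [RH_s]. *)
Lemma pow_A1_A1_RH (f : borelType X -> R) (s D : R) : 1 < s -> 0 < D ->
  measurable_fun setT f -> (forall y, 0 < f y) ->
  {ae mu, forall t, forall x e, 0 < e -> ball x e t ->
    (\int[mu]_(y in ball x e) (f y `^ s)%:E <= D%:E * mu (ball x e) * (f t `^ s)%:E)%E} ->
  in_A1 mu f /\ in_RH mu s f.
Proof.
move=> s1 D0 mf f0 aef; have s0 : 0 < s by rewrite (lt_trans _ s1).
have mfs : measurable_fun setT (fun y => f y `^ s) by exact: measurable_powR_weight.
have key x e : 0 < e -> exists m W V : R,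
    [/\ [/\ 0 < m & 0 < V], mu (ball x e) = m%:E,
     (\int[mu]_(y in ball x e) (f y)%:E = W%:E)%E /\
     (\int[mu]_(y in ball x e) (f y `^ s)%:E = V%:E)%E,
     W / m <= 2 * (V / m) `^ s^-1 &
     {ae mu, forall t, ball x e t -> (V / m) `^ s^-1 <= D `^ s^-1 * f t}].
  move=> e0; have [m m0 Em] := measure_ballE mu_doubling x e0.
  have B0 : (0 < mu (ball x e))%E by rewrite Em lte_fin.
  have aeb : {ae mu, forall t : borelType X, ball x e t ->
      (\int[mu]_(y in ball x e) (f y `^ s)%:E <= (D * m * f t `^ s)%:E)%E}.
    apply: (ae_imp aef) => t h xt; have := h x e e0 xt.
    by rewrite Em -!EFinM.
  have [t [xt]] := ae_exists (measurable_mball x e) B0 aeb.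
  have V0 : (0 < \int[mu]_(y in ball x e) (f y `^ s)%:E)%E.
    apply: ae_gt0_integral => //.
    - exact: measurable_mball.
    - by move=> y; exact: powR_ge0.
    - by apply: aeW => y; exact: powR_gt0.
  move: V0 aeb; case EV : (\int[mu]_(y in ball x e) (f y `^ s)%:E)%E => [V| |//]; last first.
    by rewrite leye_eq.
  rewrite lte_fin => V0 aeb _.
  pose l := (V / m) `^ s^-1.
  have l0 : 0 < l by rewrite powR_gt0// divr_gt0.
  have ls : l `^ s = V / m by rewrite -powRrM mulVf ?gt_eqF// powRr1// divr_ge0 ?ltW.
  (* The pointwise bound is f <= l + l^(1-s) f^s: where f > l, f = f^(1-s) f^s and 1 - s < 0. Its
     average is 2 l. *)
  have [|W EW Wle] := integral_affine_le (mu := mu) (a := l) (b := l `^ (1 - s))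
    (measurable_mball x e) mf mfs (fun y => ltW (f0 y)) (fun y => powR_ge0 _ _)
    (ltW l0) (powR_ge0 _ _) Em EV.
    apply: aeW => y _; have [fl|lf] := leP (f y) l.
      by rewrite (le_trans fl)// lerDl mulr_ge0 ?powR_ge0.
    apply: (@le_trans _ _ (l `^ (1 - s) * f y `^ s)); last by rewrite lerDr ltW.
    rewrite -[leLHS](powRr1 (ltW (f0 y))) -[X in f y `^ X](subrK s 1).
    rewrite powRD; last by apply/implyP => _; rewrite gt_eqF.
    rewrite ler_wpM2r ?powR_ge0//.
    rewrite -opprB !powRN lef_pV2 ?posrE ?(powR_gt0 _ l0) ?(powR_gt0 _ (f0 y))//.
    by rewrite ge0_ler_powR ?nnegrE ?subr_ge0 ?(ltW s1) ?(ltW l0) ?(ltW (f0 y)) ?(ltW lf).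
  exists m, W, V; split => //.
    rewrite -/l ler_pdivrMr// (le_trans Wle)//.
    have -> : V = l `^ s * m by rewrite ls divfK// gt_eqF.
    rewrite mulrA -powRD; last by apply/implyP => _; rewrite gt_eqF.
    by rewrite subrK powRr1 ?(ltW l0)//; lra.
  apply: (ae_imp aeb) => y /[apply]; rewrite lee_fin => h.
  rewrite -[X in _ <= _ * X](powRr1 (ltW (f0 y))) -(@mulfV _ s) ?gt_eqF// powRrM.
  rewrite -powRM ?powR_ge0 ?(ltW D0)//.
  rewrite ge0_ler_powR ?nnegrE ?invr_ge0 ?(ltW s0) ?divr_ge0 ?mulr_ge0 ?powR_ge0 ?(ltW D0) ?(ltW V0) ?(ltW m0)//.
  by rewrite ler_pdivrMr// mulrAC.
have wf : weight mu f.
  split; [by move=> y; exact: ltW| |exact: aeW].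
  apply: L1loc_balls => //; first by move=> y; exact: ltW.
  move=> x e e0; have [m [W [V [_ _ [EW _] _ _]]]] := key x e e0.
  by rewrite EW ltry.
have D's : 0 < D `^ s^-1 by rewrite powR_gt0.
split.
- apply: (@A1_intro _ _ _ _ (2 * D `^ s^-1)) => //; first by rewrite mulr_gt0.
  move=> x e e0; have [m [W [V [[m0 V0] Em [EW EV] h1 h2]]]] := key x e e0.
  exists m, W; split => //; apply: (ae_imp h2) => t /[apply] h.
  by rewrite (le_trans h1)// -mulrA ler_wpM2l.
- apply: (@RH_intro _ _ _ _ _ (D `^ s^-1)) => //.
  move=> x e e0; have [m [W [V [[m0 V0] Em [EW EV] h1 h2]]]] := key x e e0.
  exists m, W, V; split => //.
  rewrite mulrA ler_pdivlMr// -ler_pdivrMl// mulrA.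
  apply: (ae_cst_le_integral (measurable_mball x e) mf _ _ Em EW).
  + by move=> y; exact: ltW.
  + by rewrite mulr_ge0 ?invr_ge0 ?powR_ge0.
  + by apply: (ae_imp h2) => t /[apply]; rewrite ler_pdivrMl.
Qed.

(** The [A_1] estimate bounds w = u^(-(p-1)) above by (avg u / D)^(-(p-1)). As w^(-1/(p-1)) = u,
    this is the [A_p] condition; a lower bound of avg w by a multiple of (avg u)^(-(p-1)) then gives
    [RH_oo]. Equality of [w] with the power is asked only a.e., since the factor to which this
    applies vanishes where the original weight does. *)
Lemma A1_pow_Ap_RHoo (u w : borelType X -> R) (p D : R) : 1 < p -> 0 < D ->
  measurable_fun setT u -> measurable_fun setT w -> (forall y, 0 < u y) ->
  (forall y, 0 <= w y) -> {ae mu, forall y, w y = u y `^ (- (p - 1))} ->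
  {ae mu, forall t, forall x e, 0 < e -> ball x e t ->
    (\int[mu]_(y in ball x e) (u y)%:E <= D%:E * mu (ball x e) * (u t)%:E)%E} ->
  in_Ap mu p w /\ in_RHoo mu w.
Proof.
move=> p1 D0 meas_u mw u0 w0 wu aeu; have p0 : 0 < p - 1 by rewrite subr_gt0.
have key x e : 0 < e -> exists m W U : R,
    [/\ [/\ 0 < m, 0 < U & mu (ball x e) = m%:E],
     (\int[mu]_(y in ball x e) (w y)%:E = W%:E)%E,
     (\int[mu]_(y in ball x e) (u y)%:E = U%:E)%E,
     W / m <= (U / m / D) `^ (- (p - 1)) /\ 1 <= 2 * (2 * (U / m)) `^ (p - 1) * (W / m) &
     {ae mu, forall t, ball x e t -> w t <= (U / m / D) `^ (- (p - 1))}].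
  move=> e0; have [m m0 Em] := measure_ballE mu_doubling x e0.
  have B0 : (0 < mu (ball x e))%E by rewrite Em lte_fin.
  have aeb : {ae mu, forall t : borelType X, ball x e t ->
      (\int[mu]_(y in ball x e) (u y)%:E <= (D * m * u t)%:E)%E}.
    apply: (ae_imp aeu) => t h xt; have := h x e e0 xt.
    by rewrite Em -!EFinM.
  have [t [xt]] := ae_exists (measurable_mball x e) B0 aeb.
  have U0 : (0 < \int[mu]_(y in ball x e) (u y)%:E)%E.
    apply: ae_gt0_integral => //.
    - exact: measurable_mball.
    - by move=> y; exact: ltW.
    - exact: aeW.
  move: U0 aeb; case EU : (\int[mu]_(y in ball x e) (u y)%:E)%E => [U| |//]; last first.
    by rewrite leye_eq.
  rewrite lte_fin => U0 aeb _.
  pose M := (U / m / D) `^ (- (p - 1)).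
  have Um0 : 0 < U / m by rewrite divr_gt0.
  have UmD0 : 0 < U / m / D by rewrite divr_gt0.
  have aeM : {ae mu, forall t : borelType X, ball x e t -> w t <= M}.
    have aeb' : {ae mu, forall t, (ball x e t -> (U%:E <= (D * m * u t)%:E)%E) /\
        w t = u t `^ (- (p - 1))} by move: aeb wu; apply: filterS2.
    apply: (ae_imp aeb') => y [h ->] /h; rewrite lee_fin => hU.
    rewrite /M !powRN lef_pV2 ?posrE ?powR_gt0//.
    rewrite ge0_ler_powR ?nnegrE ?(ltW p0) ?(ltW UmD0) ?(ltW (u0 y))//.
    by rewrite ler_pdivrMr// ler_pdivrMr// (le_trans hU)//; lra.
  have M0 : 0 < M by rewrite powR_gt0.
  have [|W EW Wle] := integral_affine_le (mu := mu) (a := M) (b := 0)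
    (measurable_mball x e) mw meas_u w0 (fun y => ltW (u0 y)) (ltW M0) (lexx _) Em EU.
    by apply: (ae_imp aeM) => y /[apply]; rewrite mul0r addr0.
  rewrite mul0r addr0 in Wle.
  exists m, W, U; split => //; split; first by rewrite ler_pdivrMr.
  have k2 : 0 < 2 * (U / m) by rewrite mulr_gt0.
  pose k := (2 * (U / m)) `^ (p - 1).
  have k0 : 0 < k by rewrite powR_gt0// mulr_gt0.
  have := @le_cst_add_integral _ _ _ mu _ w u k (2 * (U / m))^-1 m W U
    (measurable_mball x e) mw meas_u w0 (fun y => ltW (u0 y)) (ltW k0) _ Em EW EU.
  rewrite invr_ge0 (ltW (mulr_gt0 (ltr0n _ 2) Um0)) => /(_ isT).
  have -> : (2 * (U / m))^-1 * U = m / 2 by field; rewrite !gt_eqF.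
  move=> H; have {}H : m <= k * W + m / 2.
    (* Either u <= 2 avg u and then k w >= 1, or the term in [u] exceeds 1. *)
    apply: H; apply: (ae_imp wu) => y -> _.
    have [uU|Uu] := leP (u y) (2 * (U / m)); last first.
      rewrite ler_wpDl ?mulr_ge0 ?powR_ge0 ?(ltW k0)//.
      by rewrite -[leLHS](mulVf (lt0r_neq0 k2)) ler_wpM2l ?invr_ge0 ?(ltW k2) ?(ltW Uu).
    rewrite ler_wpDr ?mulr_ge0 ?invr_ge0 ?(ltW (u0 y)) ?(ltW k2)//.
    rewrite powRN ler_pdivlMr ?powR_gt0// mul1r.
    by rewrite ge0_ler_powR ?nnegrE ?(ltW p0) ?(ltW (u0 y)) ?(ltW k2).
  rewrite -/k mulrA ler_pdivlMr// mul1r; lra.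
have ww : weight mu w.
  split => //.
    apply: L1loc_balls => // x e e0.
    have [m [W [U [_ EW _ _ _]]]] := key x e e0.
    by rewrite EW ltry.
  by apply: (ae_imp wu) => y ->; exact: powR_gt0.
split.
- apply: (@Ap_intro _ _ _ _ _ (D `^ (p - 1))) => // x e e0.
  have [m [W [U [[m0 U0 Em] EW EU [h1 h2] h3]]]] := key x e e0.
  exists m, W, U; split => //.
    rewrite -EU; apply: ae_eq_ge0_integral => //.
    + exact: measurable_mball.
    + exact: measurable_powR_weight.
    + by move=> y; exact: powR_ge0.
    + by move=> y; exact: ltW.
    apply: (ae_imp wu) => y ->; rewrite -powRrM mulrNN divff ?gt_eqF//.
    by rewrite powRr1// ltW.
  apply: le_trans (ler_wpM2r (powR_ge0 _ _) h1) _.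
  have UD0 : 0 < U / m / D by rewrite !divr_gt0.
  rewrite -[X in _ * X `^ _](divfK (lt0r_neq0 D0)) (powRM _ (ltW UD0) (ltW D0)).
  by rewrite powRN mulKf// gt_eqF// powR_gt0.
- apply: (@RHoo_intro _ _ _ _ (2 * (2 * D) `^ (p - 1))) => // x e e0.
  have [m [W [U [[m0 U0 Em] EW EU [h1 h2] h3]]]] := key x e e0.
  exists m, W; split => //; apply: (ae_imp h3) => t /[apply] /le_trans; apply.
  have UD : (U / m / D) `^ (- (p - 1)) * (2 * (U / m)) `^ (p - 1) = (2 * D) `^ (p - 1).
    have -> : 2 * (U / m) = U / m / D * (2 * D) by field; rewrite !gt_eqF.
    have UD0 : 0 < U / m / D by rewrite !divr_gt0.
    have D20 : 0 < 2 * D by rewrite mulr_gt0.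
    rewrite (powRM _ (ltW UD0) (ltW D20)).
    by rewrite powRN mulKf// gt_eqF// powR_gt0.
  rewrite -UD.
  have := ler_wpM2l (powR_ge0 (U / m / D) (- (p - 1))) h2; rewrite mulr1 => /le_trans; apply.
  by rewrite le_eqVlt; apply/orP; left; apply/eqP; ring.
Qed.

(** On a ball let [c] be the lower bound of [w1] and [M] the upper bound of [w2]. Then w <= M w1,
    w^s <= M^s w1^s and w^(-a) <= c^(-a) w2^(-a), so each integral involves one factor only. *)
Lemma mul_Ap_RH (w w1 w2 : X -> R) (p s : R) : 1 < p -> 1 < s -> weight mu w ->
  in_A1 mu w1 -> in_RH mu s w1 -> in_Ap mu p w2 -> in_RHoo mu w2 ->
  (forall y, w y = w1 y * w2 y) -> in_Ap mu p w /\ in_RH mu s w.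
Proof.
move=> p1 s1 ww A1w1 RHw1 Apw2 RHoow2 wE.
have p0 : 0 < p - 1 by rewrite subr_gt0.
have s0 : 0 < s by rewrite (lt_trans _ s1).
have [w_0 [mw _] _] := ww.
have [w1_0 [mw1 _] _] := A1w1.1.
have [w2_0 [mw2 _] _] := Apw2.1.
have [C1 C10 h1] := A1_bound mu_doubling A1w1.
have [C2 C20 h2] := RH_bound mu_doubling s0 RHw1.
have [A A0 h3] := Ap_bound mu_doubling p1 Apw2.
have [C3 C30 h4] := RHoo_bound RHoow2.
pose a := (p - 1)^-1.
have a0 : 0 < a by rewrite invr_gt0.
have key x e : 0 < e -> exists m W V S : R,
    [/\ 0 < m, mu (ball x e) = m%:E,
     (\int[mu]_(y in ball x e) (w y)%:E = W%:E)%E,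
     (\int[mu]_(y in ball x e) (w y `^ s)%:E = V%:E)%E /\
     (\int[mu]_(y in ball x e) (w y `^ (- a))%:E = S%:E)%E &
     W / m * (S / m) `^ (p - 1) <= C3 * C1 * A /\
     (V / m) `^ s^-1 <= C3 * C2 * C1 * (W / m)].
  move=> e0; have [m [W1 [c [[m0 W10 c0] Em EW1 aec W1c]]]] := h1 x e e0.
  have [V1 [V10 EV1 hV1]] := h2 x e m W1 e0 m0 Em EW1.
  have [m' [W2 [S2 [[_ W20 S20] Em' EW2 ES2 hA]]]] := h3 x e e0.
  have mm : m' = m by move: Em'; rewrite Em => -[].
  rewrite {m' Em'}mm in hA.
  have aeM := h4 x e m W2 e0 m0 Em EW2.
  set M := C3 * (W2 / m) in aeM.
  have ME : M = C3 * (W2 / m) by [].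
  have M0 : 0 < M by rewrite mulr_gt0// divr_gt0.
  clearbody M.
  have mB := measurable_mball x e.
  have [|W EW Wle] := integral_affine_le (mu := mu) (a := 0) (b := M)
    mB mw mw1 w_0 w1_0 (lexx _) (ltW M0) Em EW1.
    by apply: (ae_imp aeM) => t /[apply] h; rewrite add0r wE mulrC ler_wpM2r.
  have [|V EV Vle] := integral_affine_le (mu := mu) (a := 0) (b := M `^ s)
    mB (measurable_powR_weight s mw) (measurable_powR_weight s mw1)
    (fun y => powR_ge0 _ _) (fun y => powR_ge0 _ _) (lexx _) (powR_ge0 _ _) Em EV1.
    apply: (ae_imp aeM) => t /[apply] h; rewrite add0r wE mulrC -powRM ?(ltW M0)//.
    rewrite ge0_ler_powR ?nnegrE ?(ltW s0) ?mulr_ge0 ?(ltW M0)//.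
    by rewrite ler_wpM2r.
  have [|S ES Sle] := integral_affine_le (mu := mu) (a := 0) (b := c `^ (- a))
    mB (measurable_powR_weight (- a) mw) (measurable_powR_weight (- a) mw2)
    (fun y => powR_ge0 _ _) (fun y => powR_ge0 _ _) (lexx _) (powR_ge0 _ _) Em ES2.
    apply: (ae_imp aec) => t /[apply] h; rewrite add0r wE powRM//.
    rewrite ler_wpM2r ?powR_ge0// !powRN lef_pV2 ?posrE ?powR_gt0//.
      by rewrite ge0_ler_powR ?nnegrE ?(ltW a0) ?(ltW c0).
    exact: lt_le_trans h.
  have ci0 : 0 <= c^-1 by rewrite invr_ge0 ltW.
  (* [RH_s] also needs the average of [w] from below, which w2 <= w / c provides. *)
  have [|W2' EW2' W2le] := integral_affine_le (mu := mu) (a := 0) (b := c^-1)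
    mB mw2 mw w2_0 w_0 (lexx _) ci0 Em EW.
    apply: (ae_imp aec) => t /[apply] h; rewrite add0r wE mulrC ler_pdivlMr//.
    by rewrite mulrC ler_wpM2r.
  rewrite mul0r add0r in Wle; rewrite mul0r add0r in Vle.
  rewrite mul0r add0r in Sle; rewrite mul0r add0r in W2le.
  have {}W2le : c * W2 <= W.
    by move: EW2'; rewrite EW2 => -[E2]; rewrite -ler_pdivlMl// E2.
  have S0 : 0 <= S.
    by rewrite -lee_fin -ES; apply: integral_ge0 => y _; rewrite lee_fin powR_ge0.
  have V0 : 0 <= V.
    by rewrite -lee_fin -EV; apply: integral_ge0 => y _; rewrite lee_fin powR_ge0.
  have m_1 : 0 <= m^-1 by rewrite invr_ge0 ltW.
  exists m, W, V, S; split => //; split.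
  - set t := (S2 / m) `^ (p - 1) in hA.
    have t0 : 0 <= t by exact: powR_ge0.
    have St : (S / m) `^ (p - 1) <= c^-1 * t.
      have -> : c^-1 = (c `^ (- a)) `^ (p - 1).
        by rewrite -powRrM mulNr mulVf ?gt_eqF// powR_inv1// ltW.
      rewrite -powRM ?powR_ge0 ?mulr_ge0 ?(ltW S20)//.
      rewrite ge0_ler_powR ?nnegrE ?(ltW p0) ?mulr_ge0 ?powR_ge0 ?(ltW S20)//.
      by rewrite mulrA ler_wpM2r.
    apply: (@le_trans _ _ (M * (W1 / m) * (c^-1 * t))).
      apply: ler_pM; rewrite ?powR_ge0 ?mulr_ge0//.
        by rewrite -lee_fin -EW; apply: integral_ge0 => y _; rewrite lee_fin.
      by rewrite mulrA ler_wpM2r.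
    (* [A_1] replaces the average of [w1] by C1 c, and this [c] cancels the one coming from
       w^(-a). *)
    apply: (@le_trans _ _ (M * (C1 * c) * (c^-1 * t))).
      by rewrite ler_wpM2r ?mulr_ge0 ?invr_ge0 ?(ltW c0)// ler_wpM2l ?(ltW M0).
    have -> : M * (C1 * c) * (c^-1 * t) = C3 * C1 * (W2 / m * t).
      by rewrite ME; field; rewrite !gt_eqF.
    by rewrite ler_wpM2l// mulr_ge0 ?(ltW C30) ?(ltW C10).
  - apply: (@le_trans _ _ (M * (V1 / m) `^ s^-1)).
      have Ms : M = (M `^ s) `^ s^-1.
        by rewrite -powRrM mulfV ?gt_eqF// powRr1// ltW.
      rewrite [X in _ <= X * _]Ms.
      rewrite -powRM ?powR_ge0 ?mulr_ge0 ?(ltW V10)//.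
      rewrite ge0_ler_powR ?nnegrE ?invr_ge0 ?(ltW s0) ?mulr_ge0 ?powR_ge0 ?(ltW V10)//.
      by rewrite mulrA ler_wpM2r.
    apply: (@le_trans _ _ (M * (C2 * (C1 * c)))).
      rewrite ler_wpM2l ?(ltW M0)// (le_trans hV1)//.
      by rewrite ler_wpM2l ?(ltW C20).
    have -> : M * (C2 * (C1 * c)) = C3 * C2 * C1 * (c * W2 / m) by rewrite ME; ring.
    rewrite ler_wpM2l ?mulr_ge0 ?(ltW C30) ?(ltW C20) ?(ltW C10)//.
    by rewrite ler_wpM2r.
split.
- apply: (@Ap_intro _ _ _ _ _ (C3 * C1 * A)) => // x e e0.
  have [m [W [V [S [m0 Em EW [EV ES] [k1 k2]]]]]] := key x e e0.
  by exists m, W, S.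
- apply: (@RH_intro _ _ _ _ _ (C3 * C2 * C1)) => // x e e0.
  have [m [W [V [S [m0 Em EW [EV ES] [k1 k2]]]]]] := key x e e0.
  by exists m, W, V.
Qed.

Lemma Ap_RH_factor (w : X -> R) (p s : R) : 1 < p -> 1 < s ->
  in_Ap mu p w -> in_RH mu s w -> exists w1 w2 : X -> R,
    [/\ in_A1 mu w1 /\ in_RH mu s w1, in_Ap mu p w2 /\ in_RHoo mu w2 &
      forall y, w y = w1 y * w2 y].
Proof.
move=> p1 s1 Apw RHw.
have p0 : 0 < p - 1 by rewrite subr_gt0.
have s0 : 0 < s by rewrite (lt_trans _ s1).
have [w_0 [mw _] aew] := Apw.1.
have [A A0 h1] := Ap_bound mu_doubling p1 Apw.
have [C C0 h2] := RH_bound mu_doubling s0 RHw.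
pose a := (p - 1)^-1.
pose r := s * (p - 1).
have r0 : 0 < r by rewrite mulr_gt0.
(* Changing the zeros of [w] to 1 alters it on a null set and makes v sg^r = 1 hold at every
   point. *)
pose N : set (borelType X) := [set y | w y = 0].
have mN : measurable N.
  by rewrite -[N]setTI; exact: (mw measurableT [set 0] (measurable_set1 0)).
pose w' : borelType X -> R := fun y => w y + \1_N y.
have w'0 y : 0 < w' y.
  have := w_0 y; rewrite le_eqVlt => /orP[/eqP wy|wy].
    by rewrite /w' -wy add0r indicE mem_set.
  by rewrite (lt_le_trans wy)// lerDl.
have mw' : measurable_fun setT w' by apply: measurable_funD => //; exact: measurable_indic.
have ww' : {ae mu, forall y, w y = w' y}.
  apply: (ae_imp aew) => y wy; rewrite /w' indicE memNset ?addr0// /N/= => wy0.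
  by rewrite wy0 ltxx in wy.
pose v y := w' y `^ s.
pose sg y := w' y `^ (- a).
have mv : measurable_fun setT v by exact: measurable_powR_weight.
have msg : measurable_fun setT sg by exact: measurable_powR_weight.
have v0 y : 0 < v y by exact: powR_gt0.
have sg0 y : 0 < sg y by exact: powR_gt0.
have vs y : v y * sg y `^ r = 1.
  rewrite /v /sg -powRrM -powRD; last by apply/implyP => _; rewrite gt_eqF.
  by rewrite /a /r [X in _ `^ X](_ : _ = 0) ?powRr0//; field; rewrite gt_eqF.
have vsA (x : X) (e : R) : 0 < e -> exists m V S : R,
  [/\ [/\ 0 < m, 0 < V & 0 < S], mu (ball x e) = m%:E,
      (\int[mu]_(y in ball x e) (v y)%:E = V%:E)%E,
      (\int[mu]_(y in ball x e) (sg y)%:E = S%:E)%E &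
      V * S `^ r <= (C * A) `^ s * m `^ (r + 1)].
  move=> e0; have [m [W [S [[m0 W0 S0] Em EW ES hA]]]] := h1 x e e0.
  have [V [V0 EV hV]] := h2 x e m W e0 m0 Em EW.
  have mB := measurable_mball x e.
  exists m, V, S; split; [by split|exact: Em|..].
  - rewrite -EV; apply: ae_eq_ge0_integral => //.
    + exact: measurable_powR_weight.
    + by move=> y; exact: ltW.
    + by move=> y; exact: powR_ge0.
    + by apply: (ae_imp ww') => y ->.
  - rewrite -ES; apply: ae_eq_ge0_integral => //.
    + exact: measurable_powR_weight.
    + by move=> y; exact: ltW.
    + by move=> y; exact: powR_ge0.
    + by apply: (ae_imp ww') => y ->.
  have Vm0 : 0 < V / m by rewrite divr_gt0.
  have Sm0 : 0 < S / m by rewrite divr_gt0.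
  have Wm0 : 0 < W / m by rewrite divr_gt0.
  (* [RH_s] followed by [A_p]; the s-th power is the required condition with r = s (p - 1). *)
  have k : (V / m) `^ s^-1 * (S / m) `^ (p - 1) <= C * A.
    apply: le_trans (ler_wpM2r (powR_ge0 _ _) hV) _.
    by rewrite -mulrA ler_wpM2l// ltW.
  have := ge0_ler_powR (ltW s0) _ _ k.
  rewrite !nnegrE !mulr_ge0 ?powR_ge0 ?(ltW C0) ?(ltW A0)// => /(_ isT isT).
  rewrite powRM ?powR_ge0// -!powRrM mulVf ?gt_eqF// powRr1 ?(ltW Vm0)// [(p - 1) * s]mulrC -/r => {}k.
  have -> : V = V / m * m by rewrite divfK// gt_eqF.
  have -> : S `^ r = (S / m) `^ r * m `^ r.
    by rewrite -powRM ?(ltW Sm0) ?(ltW m0)// divfK// gt_eqF.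
  have -> : m `^ (r + 1) = m `^ r * m.
    by rewrite powRD ?powRr1 ?(ltW m0)//; apply/implyP => _; rewrite gt_eqF.
  have := ler_wpM2r (mulr_ge0 (powR_ge0 m r) (ltW m0)) k.
  by apply: ler_trans_eq; ring.
have CA0 : 0 < (C * A) `^ s by rewrite powR_gt0// mulr_gt0.
have [D [z [D0 mz z0 aez]]] :=
  dual_pair_factor mu_doubling r0 CA0 mv msg v0 sg0 vs vsA.
(* The s-th power of the first factor is z^r. The second keeps the original [w], so the product is
   right even at the zeros of [w], and it equals (z sg)^(-(p-1)) almost everywhere. *)
exists (fun y => z y `^ (p - 1)), (fun y => z y `^ (- (p - 1)) * w y); split.
- apply: (@pow_A1_A1_RH _ s D) => //.
  + exact: measurable_powR_weight.
  + by move=> y; exact: powR_gt0.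
  + apply: (ae_imp aez) => t h x e e0 xt; have [_ k] := h x e e0 xt.
    under eq_integral do rewrite -powRrM [(p - 1) * s]mulrC.
    by rewrite -powRrM [(p - 1) * s]mulrC.
- apply: (@A1_pow_Ap_RHoo (fun y => z y * sg y) _ p D) => //.
  + exact: measurable_funM.
  + by apply: measurable_funM => //; exact: measurable_powR_weight.
  + by move=> y; exact: mulr_gt0.
  + by move=> y; rewrite mulr_ge0 ?powR_ge0.
  + apply: (ae_imp ww') => y ->; rewrite powRM ?ltW//; congr (_ * _).
    by rewrite /sg -powRrM mulrNN /a mulVf ?gt_eqF// powRr1// ltW.
  + by apply: (ae_imp aez) => t h x e e0 xt; have [k _] := h x e e0 xt.
- by move=> y; rewrite mulrA powRN mulfV ?mul1r// gt_eqF// powR_gt0.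
Qed.

End classes.

Theorem theorem1p3 (R : realType) (X : completeMetricType R)
    (mu : {measure set (borelType X) -> \bar R})
    (hdoubling : doubling mu) (hannular : annular_decay mu)
    (p s : R) (hp : 1 < p) (hs : 1 < s)
    (w : X -> R) (hw : weight mu w) :
  (in_Ap mu p w /\ in_RH mu s w) <->
  exists w1 w2 : X -> R,
    [/\ in_A1 mu w1 /\ in_RH mu s w1,
        in_Ap mu p w2 /\ in_RHoo mu w2
      & forall y, w y = w1 y * w2 y].
Proof.
split=> [[Apw RHw]|[w1 [w2 [[A1w1 RHw1] [Apw2 RHoow2] wE]]]].
  exact: Ap_RH_factor.
exact: (mul_Ap_RH hdoubling hp hs hw A1w1 RHw1 Apw2 RHoow2 wE).
Qed.
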